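(* Let $\Phi$ be a measurable quasi-compact linear cocycle over $\theta$ whose generator $A$ satisfies $\int_\Omega\ln^+\|A(\omega)\|\,d\mathbb P(\omega)<\infty$. Assume that there exist a $\theta$-invariant Borel set $\widetilde\Omega\subset\Omega$ of full measure and random variables $\zeta,\eta:\Omega\to(0,\infty)$ such that the pair $(\ell^\infty_{1/\zeta}(\widetilde\Omega\times\mathbb Z),\ell^\infty_1(\widetilde\Omega\times\mathbb Z))$ is measurably properly admissible for $\Phi$ and that, for every $\omega\in\widetilde\Omega$ and $f\in\ell^\infty_{1/\zeta(\omega)}(\mathbb Z)$, $$\|x\|_{\ell^\infty_1(\mathbb Z)}\le\eta(\omega)\|f\|_{\ell^\infty_{1/\zeta(\omega)}(\mathbb Z)},$$ where $x\in\ell^\infty_1(\mathbb Z)$ is the unique solution in $\ell^\infty_1(\mathbb Z)$ of $x(n+1)=A(\theta^n\omega)x(n)+f(n+1)$, $n\in\mathbb Z$. Then $\Phi$ has a tempered exponential dichotomy.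
   Context: Notation. $X=(X,|\cdot|)$ is a separable Banach space; $\mathcal L(X)$ is the Banach space of bounded linear operators on $X$ with operator norm $\|\cdot\|$; $\mathcal R(P)$ is the range of $P$; $\mathbb Z_+$ (resp. $\mathbb Z_-$) is the set of nonnegative (resp. nonpositive) integers. $\Omega$ is a compact metric space with Borel $\sigma$-algebra $\mathcal F$, $\mathbb P$ is a probability measure on $(\Omega,\mathcal F)$, and $\theta:\Omega\to\Omega$ is an invertible measurable transformation (with measurable inverse) preserving $\mathbb P$; $\mathbb P$ is ergodic, i.e. $\mathbb P(E)\in\{0,1\}$ for each $E\in\mathcal F$ with $\theta^{-1}(E)=E$. A random variable is a measurable function; a function $g$ on $\Omega$ is $\theta$-invariant if $g(\theta\omega)=g(\omega)$ for all $\omega$. A set $\widetilde\Omega$ is $\theta$-invariant if $\theta(\widetilde\Omega)=\widetilde\Omega$; full measure means null complement. Cocycles. A measurable linear cocycle over $\theta$ is a map $\Phi:\mathbb Z_+\times\Omega\to\mathcal L(X)$ with $\Phi(0,\omega)=\mathrm{Id}$, $\Phi(n+m,\omega)=\Phi(m,\theta^n\omega)\Phi(n,\omega)$ for all $\omega\in\Omega$, $n,m\in\mathbb Z_+$, and such that $\omega\mapsto\Phi(n,\omega)$ is strongly measurable for each $n$ (i.e. $\omega\mapsto\Phi(n,\omega)x$ is measurable for each $x\in X$). Its generator is $A(\omega):=\Phi(1,\omega)$. A random variable $K:\Omega\to(0,+\infty)$ is tempered (with respect to $\theta$) if $\lim_{n\to\pm\infty}\frac{\ln K(\theta^n\omega)}{n}=0$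 for $\mathbb P$-a.e. $\omega\in\Omega$. Quasi-compactness. For $T\in\mathcal L(X)$, the index of compactness $\kappa_{ic}(T)$ is the infimum of $r$ such that $T(B_X(0,1))$ has a finite cover by balls of radius $r$, where $B_X(0,1)$ is the unit ball of $X$ centered at $0$. If $\int_\Omega\ln^+\|A\|\,d\mathbb P<\infty$, there are constants $-\infty\le\kappa^*\le\lambda^*<\infty$ with $\kappa^*=\lim_{n\to\infty}\frac1n\ln\kappa_{ic}(\Phi(n,\omega))$ and $\lambda^*=\lim_{n\to\infty}\frac1n\ln\|\Phi(n,\omega)\|$ for $\mathbb P$-a.e. $\omega$. The cocycle $\Phi$ is quasi-compact if $\kappa^*<\lambda^*$. Tempered exponential dichotomy. $\Phi$ has a tempered exponential dichotomy if there is a strongly measurable map $\Pi^s:\widetilde\Omega\to\mathcal L(X)$, defined on some $\theta$-invariant set $\widetilde\Omega\subset\Omega$ of full measure (not necessarily the set $\widetilde\Omega$ of the claim), such that, with $\Pi^u(\omega):=\mathrm{Id}-\Pi^s(\omega)$: (i) $\Pi^s(\omega)$ is a projection for every $\omega\in\widetilde\Omega$; (ii) $\Pi^s(\theta^n\omega)\Phi(n,\omega)=\Phi(n,\omega)\Pi^s(\omega)$ for all $\omega\in\widetilde\Omega$, $n\in\mathbb Z_+$; (iii) $\Phi(n,\omega)|_{\mathcal R(\Pi^u(\omega))}$ is an isomorphism from $\mathcal R(\Pi^u(\omega))$ onto $\mathcal R(\Pi^u(\theta^n\omega))$ for all $\omega\in\widetilde\Omega$, $n\in\mathbb Z_+$,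 and $\omega\mapsto\Phi(n,\omega)\Pi^u(\omega)$ is strongly measurable for $n\in\mathbb Z_-$, where for $n\in\mathbb Z_-$, $\Phi(n,\omega):=(\Phi(-n,\theta^n\omega)|_{\mathcal R(\Pi^u(\theta^n\omega))})^{-1}$; (iv) there are a $\theta$-invariant random variable $\alpha:\Omega\to(0,+\infty)$ and a tempered random variable $K:\Omega\to(0,+\infty)$ such that $\|\Phi(n,\omega)\Pi^s(\omega)\|\le K(\omega)e^{-\alpha(\omega)n}$ for $\omega\in\widetilde\Omega$, $n\in\mathbb Z_+$, and $\|\Phi(n,\omega)\Pi^u(\omega)\|\le K(\omega)e^{\alpha(\omega)n}$ for $\omega\in\widetilde\Omega$, $n\in\mathbb Z_-$. Sequence spaces. For a random variable $\zeta:\Omega\to(0,\infty)$ and $\omega\in\Omega$, $\ell^\infty_{1/\zeta(\omega)}(\mathbb Z)$ is the Banach space of sequences $f=(f(n))_{n\in\mathbb Z}\subset X$ with finite norm $\sup_{n\in\mathbb Z}(\zeta(\theta^n\omega)|f(n)|)$, and $\ell^\infty_1(\mathbb Z)$ is the Banach space of bounded sequences in $X$ with the norm $\sup_{n\in\mathbb Z}|f(n)|$. $\ell^\infty_{1/\zeta}(\widetilde\Omega\times\mathbb Z)$ (resp. $\ell^\infty_1(\widetilde\Omega\times\mathbb Z)$) is the set of all $f:\widetilde\Omega\times\mathbb Z\to X$ with $f(\omega,\cdot)\in\ell^\infty_{1/\zeta(\omega)}(\mathbb Z)$ (resp. $\ell^\infty_1(\mathbb Z)$) for every $\omega\in\widetilde\Omega$.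 Admissibility. A pair $(\mathcal Y,\mathcal Z)$ of such classes of functions on $\widetilde\Omega\times\mathbb Z$ is measurably properly admissible for $\Phi$ if for each $f\in\mathcal Y$ there is a unique $x\in\mathcal Z$ with $x(\omega,n+1)=A(\theta^n\omega)x(\omega,n)+f(\omega,n+1)$ for all $n\in\mathbb Z$, $\omega\in\widetilde\Omega$, and moreover, whenever $\omega\mapsto f(\omega,n)$ is measurable for each $n\in\mathbb Z$, this unique $x$ is such that $\omega\mapsto x(\omega,n)$ is measurable for each $n\in\mathbb Z$. *)

(* Defs.v *)
From HB Require Import structures.
From mathcomp Require Import all_boot all_order all_algebra.
From mathcomp Require Import all_classical all_reals all_analysis.

Set Implicit Arguments.
Unset Strict Implicit.
Unset Printing Implicit Defensive.

Import Order.TTheory GRing.Theory Num.Theory.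
Import numFieldNormedType.Exports.

Local Open Scope classical_set_scope.
Local Open Scope ring_scope.

(* [measurableType]s are pointed, hence so must be a metric space that is to
   carry a Borel sigma-algebra; a probability space is nonempty anyway. *)
#[short(type="pointedMetricType")]
HB.structure Definition PointedMetric (K : numDomainType) :=
  {M of Metric K M & Pointed M}.

Notation borel T := (g_sigma_algebraType (@open T)).

Definition separable (T : topologicalType) : Prop :=
  exists2 D : set T, countable D & dense D.

Section bounded_operators.
Context {R : realType} {X : normedModType R}.

Record bounded_op := BoundedOp {
  bounded_op_linear :> {linear X -> X} ;
  bounded_op_continuous : continuous bounded_op_linear }.

(* Extended-real valued and defined for every map [F], so that a finite upper
   bound on [opnorm F] includes the boundedness of [F]. *)
Definition opnorm (F : X -> X) : \bar R :=
  ereal_sup [set (`|F x|)%:E | x in [set x | `|x| <= 1]].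

Definition has_finite_ball_cover (A : set X) (r : R) : Prop :=
  exists2 C : set X, finite_set C & A `<=` \bigcup_(c in C) ball c r.

Definition compactness_index (F : X -> X) : \bar R :=
  ereal_inf [set r%:E | r in has_finite_ball_cover (F @` ball (0 : X) 1)].

Definition weighted_sup_norm (z : int -> R) (u : int -> X) : \bar R :=
  ereal_sup [set (z n * `|u n|)%:E | n in [set: int]].

Definition weighted_ell_infty (z : int -> R) : set (int -> X) :=
  [set u | (weighted_sup_norm z u < +oo)%E].

Definition sup_norm (u : int -> X) : \bar R := weighted_sup_norm (fun=> 1) u.

Definition ell_infty1 : set (int -> X) := [set u | (sup_norm u < +oo)%E].

End bounded_operators.
Arguments bounded_op {R} X.

Section base_system.
Context d {T : measurableType d} {R : realType} (P : probability T R).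

Record invertible_mpt := InvertibleMPT {
  mpt_fun :> T -> T ;
  mpt_inv : T -> T ;
  mpt_funK : cancel mpt_fun mpt_inv ;
  mpt_invK : cancel mpt_inv mpt_fun ;
  measurable_mpt_fun : measurable_fun [set: T] mpt_fun ;
  measurable_mpt_inv : measurable_fun [set: T] mpt_inv ;
  mpt_preserving : forall E, measurable E -> P (mpt_fun @^-1` E) = P E }.

Definition mpt_iter (theta : invertible_mpt) (n : int) (w : T) : T :=
  match n with
  | Posz k => iter k theta w
  | Negz k => iter k.+1 (mpt_inv theta) w
  end.

Definition ergodic (theta : invertible_mpt) : Prop :=
  forall E, measurable E -> theta @^-1` E = E -> P E = 0%E \/ P E = 1%E.

Definition full_measure (A : set T) : Prop :=
  measurable A /\ P (~` A) = 0%E.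

Definition invariant_set (theta : invertible_mpt) (A : set T) : Prop :=
  theta @` A = A.

Definition invariant_fun (theta : invertible_mpt) (g : T -> R) : Prop :=
  forall w, g (theta w) = g w.

Definition positive_rv (g : T -> R) : Prop :=
  measurable_fun [set: T] g /\ forall w, 0 < g w.

Definition tempered (theta : invertible_mpt) (K : T -> R) : Prop :=
  {ae P, forall w,
    (fun n : nat => ln (K (mpt_iter theta n%:Z w)) / n%:R) @ \oo --> (0 : R) /\
    (fun n : nat => ln (K (mpt_iter theta (- n%:Z) w)) / - n%:R) @ \oo
      --> (0 : R)}.

End base_system.

Section cocycles.
Context d {T : measurableType d} {R : realType} {P : probability T R}.
Context (theta : invertible_mpt P) {X : completeNormedModType R}.
Implicit Types (Phi : nat -> T -> bounded_op X) (D : set T).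

Definition strongly_measurable D (F : T -> X -> X) : Prop :=
  forall x, measurable_fun D (fun w => F w x : borel X).

Definition measurable_cocycle Phi : Prop :=
  [/\ forall w x, Phi 0%N w x = x,
      forall n m w x,
        Phi (n + m)%N w x = Phi m (mpt_iter theta n%:Z w) (Phi n w x)
    & forall n, strongly_measurable [set: T] (Phi n)].

Definition generator Phi : T -> bounded_op X := Phi 1%N.

Definition log_integrable Phi : Prop :=
  (\int[P]_w maxe 0 (lne (opnorm (generator Phi w))) < +oo)%E.

(* [kappa] and [lambda] are the almost sure growth rates, determined uniquely
   by the two limits; for a measurable cocycle with [log_integrable Phi] they
   always exist. *)
Definition quasi_compact Phi : Prop :=
  exists kappa lambda : \bar R,
    [/\ {ae P, forall w, (fun n : nat =>
          (n%:R^-1)%:E * lne (compactness_index (Phi n w)))%E @ \oo --> kappa},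
        {ae P, forall w, (fun n : nat =>
          (n%:R^-1)%:E * lne (opnorm (Phi n w)))%E @ \oo --> lambda},
        (lambda < +oo)%E
      & (kappa < lambda)%E].

Definition complementary (Q : T -> bounded_op X) (w : T) (x : X) : X :=
  x - Q w x.

(* The map written Phi(-m, w) on the range of [Pu w]: the inverse of
   Phi(m, theta^(-m) w) restricted to the range of [Pu (theta^(-m) w)]. *)
Definition cocycle_neg Phi (Pu : T -> X -> X) (m : nat) (w : T) : X -> X :=
  let v := mpt_iter theta (- m%:Z) w in
  'pinv_(fun=> 0) (range (Pu v)) (Phi m v).

(* On the ranges of [Pu], which are closed, [set_bij] is the isomorphism
   condition; the last bound makes the boundedness of the inverses explicit.
   A map on [Ot] is a map on the whole space considered on [Ot] only. *)
Definition tempered_exponential_dichotomy Phi : Prop :=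
  exists (Ot : set T) (Ps : T -> bounded_op X),
  let Pu := complementary Ps in
  [/\ [/\ invariant_set theta Ot, full_measure P Ot
        & strongly_measurable Ot Ps],
      forall w, Ot w -> forall x, Ps w (Ps w x) = Ps w x,
      forall w, Ot w -> forall (n : nat) x,
        Ps (mpt_iter theta n%:Z w) (Phi n w x) = Phi n w (Ps w x),
      (forall w, Ot w -> forall n : nat,
        set_bij (range (Pu w)) (range (Pu (mpt_iter theta n%:Z w)))
          (Phi n w)) /\
      (forall m : nat,
        strongly_measurable Ot
          (fun w x => cocycle_neg Phi Pu m w (Pu w x)))
    & exists alpha K : T -> R,
      [/\ positive_rv alpha, invariant_fun theta alpha,
          positive_rv K, tempered theta K
        & forall w, Ot w -> forall n : nat,
          (opnorm (fun x => Phi n w (Ps w x)) <=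
            (K w * expR (- alpha w * n%:R))%:E)%E /\
          (opnorm (fun x => cocycle_neg Phi Pu n w (Pu w x)) <=
            (K w * expR (alpha w * - n%:R))%:E)%E]].

Definition orbit_weight (zeta : T -> R) (w : T) (n : int) : R :=
  zeta (mpt_iter theta n w).

(* Functions on [Ot] x Z are represented by functions on the whole of T x Z
   of which only the values on [Ot] matter. *)
Definition ell_infty_on (Ot : set T) (zeta : T -> R) : set (T -> int -> X) :=
  [set f | forall w, Ot w -> weighted_ell_infty (orbit_weight zeta w) (f w)].

Definition ell_infty1_on (Ot : set T) : set (T -> int -> X) :=
  [set f | forall w, Ot w -> ell_infty1 (f w)].

Definition solution_at Phi (w : T) (f x : int -> X) : Prop :=
  forall n : int,
    x (n + 1) = generator Phi (mpt_iter theta n w) (x n) + f (n + 1).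

Definition measurable_on (Ot : set T) (f : T -> int -> X) : Prop :=
  forall n, measurable_fun Ot (fun w => f w n : borel X).

Definition measurably_properly_admissible Phi (Ot : set T)
    (Y Z : set (T -> int -> X)) : Prop :=
  forall f, Y f -> exists x,
    [/\ Z x,
        forall w, Ot w -> solution_at Phi w (f w) (x w),
        forall x', Z x' -> (forall w, Ot w -> solution_at Phi w (f w) (x' w)) ->
          forall w, Ot w -> forall n, x' w n = x w n
      & measurable_on Ot f -> measurable_on Ot x].

End cocycles.
Arguments log_integrable {d T R} P {X} Phi.
Arguments quasi_compact {d T R} P {X} Phi.

(* Main.v *)
Require Import Defs.
From HB Require Import structures.
From mathcomp Require Import all_boot all_order all_algebra.
From mathcomp Require Import all_classical all_reals all_analysis.
From mathcomp Require Import measurable_realfun ring lra zify.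

Set Implicit Arguments.
Unset Strict Implicit.
Unset Printing Implicit Defensive.

Import Order.TTheory GRing.Theory Num.Theory.
Import numFieldNormedType.Exports.

Local Open Scope classical_set_scope.
Local Open Scope ring_scope.

(** Feeding the admissibility hypothesis with the impulse equal to [v] at time 0
    yields a bounded solution [green v w].  Its value at time 0 is the stable
    component of [v]: for nonnegative times it is a bounded forward orbit, and
    for negative times it is, up to sign, the bounded backward orbit of
    [v - green v w 0].  Bounded solutions are unique, so this splits the space
    into a stable and an unstable part and the cocycle preserves the splitting
    ([green_cocycle], [cocycle_injective_unstable]).  Measurability of the
    projections is part of the admissibility hypothesis.

    Exponential decay.  If [x] is an orbit in one of the two parts, the bound for
    forcing terms proportional to [x k / (zeta_k * |x k|)] reads
    [|x n| * \sum_(k < n) (zeta_k * |x k|)^-1 <= c] ([green_summed],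
    [back_summed]).  Hence the sums grow by a fixed factor each time the weight
    is at most [c], and [|x n|] decays at an exponential rate as soon as this
    happens with positive frequency ([decay_of_summed_bound]).  The frequency
    comes from the maximal ergodic inequality and ergodicity
    ([half_avoids_full]).  An admissibility bound that holds at a later point of
    the orbit also holds at [w] ([admissible_bound_iter]), so one visit to the
    set where [eta] is at most [c] allows replacing [eta w] by [c].

    Temperedness.  Let [K w] be one plus the least constant in the exponential
    bounds at [w].  Both stable and unstable bounds at [w] are controlled by
    those at [theta w], because the unstable part of [v] belongs to the backward
    orbit of its image under the generator: [K w <= (2 + e^alpha * |A w|) *
    K (theta w)] ([dichotomy_bound_step]).  Thus [ln K - ln K \o theta] is at
    most an integrable function, and this one-sided integrability forces [ln K]
    to grow sublinearly along almost every orbit, in both time directions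
    ([tempered_of_step]): truncating [ln K] at a high level [c] makes the
    increments have a small integral, and the maximal inequality turns this into
    a small growth rate outside a small set. *)

(** * The maximal ergodic inequality *)

Section maximal_inequality.
Context d {T : measurableType d} {R : realType} (P : probability T R).
Context (tau : T -> T) (mtau : measurable_fun [set: T] tau).
Hypothesis tauP : forall E, measurable E -> P (tau @^-1` E) = P E.

Definition orbit_sum (f : T -> R) (n : nat) (w : T) : R :=
  \sum_(k < n) f (iter k tau w).

Lemma orbit_sumS f n w :
  orbit_sum f n.+1 w = f w + orbit_sum f n (tau w).
Proof.
rewrite /orbit_sum big_ord_recl /=; congr (_ + _).
by apply: eq_bigr => i _; rewrite /= -iterSr iterS.
Qed.

Lemma measurable_iter k : measurable_fun [set: T] (iter k tau).
Proof.
elim: k => [|k IH] /=; first exact: measurable_id.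
exact: (measurableT_comp mtau IH).
Qed.

Lemma measurable_orbit_sum f n : measurable_fun [set: T] f ->
  measurable_fun [set: T] (orbit_sum f n).
Proof.
move=> mf; apply: measurable_sum => i.
exact: (measurableT_comp mf (measurable_iter i)).
Qed.

Lemma integral_comp_preserving (f : T -> R) :
  measurable_fun [set: T] f -> (forall w, 0 <= f w) ->
  (\int[P]_w (f (tau w))%:E = \int[P]_w (f w)%:E)%E.
Proof.
move=> mf f0.
have := @ge0_integral_pushforward _ _ _ _ _ _ mtau P setT (EFin \o f)
  measurableT.
rewrite preimage_setT /= => <-; [|exact/measurable_EFinP|
  by move=> y _; rewrite lee_fin].
by apply: eq_measure_integral => A mA _; exact: tauP.
Qed.

(** The maximum over [n <= N] of the sum of [f - l] along the first [n] points of
    the orbit, with the empty sum included; the recursive form is the one that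
    compares it with its value at [tau w]. *)
Fixpoint max_excess (f : T -> R) (l : R) (N : nat) (w : T) : R :=
  if N is N'.+1 then Num.max 0 (f w - l + max_excess f l N' (tau w)) else 0.

Section bound.
Context (f : T -> R) (l : R).
Hypothesis mf : measurable_fun [set: T] f.
Hypothesis f0 : forall w, 0 <= f w.
Hypothesis l0 : 0 < l.

Let M := max_excess f l.

Lemma max_excess_ge0 N w : 0 <= M N w.
Proof. by case: N => [|N] //=; rewrite le_max lexx. Qed.

Lemma max_excess_leS N w : M N w <= M N.+1 w.
Proof.
elim: N w => [|N IH] w; first exact: max_excess_ge0.
rewrite /M /= ge_max le_max lexx /= le_max; apply/orP; right.
by rewrite lerD2l; exact: IH.
Qed.

Lemma max_excess_le N w : M N.+1 w <= f w + M N (tau w).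
Proof.
rewrite {1}/M /= ge_max addr_ge0 ?f0 ?max_excess_ge0 //=.
by rewrite -/(M N (tau w)) lerD2r gerBl ltW.
Qed.

Lemma orbit_sum_le_max_excess n N w : (n <= N)%N ->
  orbit_sum f n w - l * n%:R <= M N w.
Proof.
elim: N n w => [|N IH] [|n] w //= nN; rewrite ?mulr0 ?subr0.
- by rewrite /orbit_sum big_ord0 max_excess_ge0.
- by rewrite /orbit_sum big_ord0 max_excess_ge0.
rewrite orbit_sumS /M /= le_max; apply/orP; right.
have := IH n (tau w) nN; rewrite -/(M N _) -natr1 mulrDr mulr1.
move: (orbit_sum _ _ _) (M _ _) => a b; lra.
Qed.

Lemma measurable_max_excess N : measurable_fun [set: T] (M N).
Proof.
elim: N => [|N IH]; first exact: measurable_cst.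
rewrite /M /=; apply: (measurable_maxr (f := fun=> 0)) => //.
apply: measurable_funD; last exact: (measurableT_comp IH).
by apply: measurable_funB.
Qed.

Lemma max_excess_step N w :
  M N w + l * \1_[set v | 0 < M N v] w <= f w + M N (tau w).
Proof.
rewrite indicE; have [pos|le0] := ltP 0 (M N w).
  rewrite mem_set //= mulr1.
  case: N pos => [|N] pos; first by rewrite /M /= ltxx in pos.
  have eM : M N.+1 w = f w - l + M N (tau w).
    move: pos; rewrite /M /= -/(M N (tau w)) lt_max ltxx /=.
    by move=> /ltW; rewrite -/M => /max_idPr.
  have := max_excess_leS N (tau w); rewrite -/M eM; lra.
rewrite memNset /=; last by apply/negP; rewrite -leNgt.
rewrite mulr0 addr0; apply: (le_trans le0).
by rewrite addr_ge0 ?f0 ?max_excess_ge0.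
Qed.

Lemma integral_max_excess N : (\int[P]_w (f w)%:E < +oo)%E ->
  (\int[P]_w (M N w)%:E < +oo)%E.
Proof.
move=> fi; elim: N => [|N IH].
  by under eq_integral do rewrite /M /=; rewrite integral0.
apply: (@le_lt_trans _ _ (\int[P]_w ((f w)%:E + (M N (tau w))%:E))%E).
  apply: ge0_le_integral => //.
  - by move=> w _; rewrite lee_fin max_excess_ge0.
  - exact/measurable_EFinP/measurable_max_excess.
  - apply: emeasurable_funD; apply/measurable_EFinP => //.
    exact: (measurableT_comp (measurable_max_excess N)).
  - by move=> w _; rewrite -EFinD lee_fin max_excess_le.
rewrite ge0_integralD //=; last 1 first.
- apply/measurable_EFinP.
  exact: (measurableT_comp (measurable_max_excess N)).
- rewrite (integral_comp_preserving (measurable_max_excess N)).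
    by rewrite lte_add_pinfty.
  exact: max_excess_ge0.
- by move=> w _; rewrite lee_fin.
- exact/measurable_EFinP.
- by move=> w _; rewrite lee_fin max_excess_ge0.
Qed.

Lemma measurable_max_excess_gt0 N : measurable [set w | 0 < M N w].
Proof.
have := measurable_max_excess N measurableT (measurable_itv `]0%R, +oo[).
rewrite setTI; congr measurable.
by apply/seteqP; split => w /=; rewrite in_itv /= andbT.
Qed.

(** Since all terms of [max_excess_step] are nonnegative it can be integrated,
    and the equal finite integrals of [M N] and [M N \o tau] cancel. *)
Lemma measure_max_excess_gt0 N : (\int[P]_w (f w)%:E < +oo)%E ->
  (l%:E * P [set w | (0 < M N w)%R] <= \int[P]_w (f w)%:E)%E.
Proof.
move=> fi; have mM := measurable_max_excess N.
have mA := measurable_max_excess_gt0 N.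
have M0 w : [set: T] w -> (0%:E <= (M N w)%:E)%E.
  by rewrite lee_fin max_excess_ge0.
have : (\int[P]_w ((M N w)%:E + (l * \1_[set v | 0 < M N v] w)%:E) <=
        \int[P]_w ((f w)%:E + (M N (tau w))%:E))%E.
  apply: ge0_le_integral => //.
  - move=> w _; rewrite -EFinD lee_fin addr_ge0 ?max_excess_ge0 //.
    by rewrite mulr_ge0 // ltW.
  - apply: emeasurable_funD; apply/measurable_EFinP => //.
    by apply: measurable_funM => //; exact: measurable_indic.
  - apply: emeasurable_funD; apply/measurable_EFinP => //.
    exact: (measurableT_comp mM).
  - by move=> w _; rewrite -!EFinD lee_fin max_excess_step.
rewrite ge0_integralD //; last 3 first.
- exact/measurable_EFinP.
- by move=> w _; rewrite lee_fin mulr_ge0 // ltW.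
- by apply/measurable_EFinP/measurable_funM => //; exact: measurable_indic.
rewrite [leRHS]ge0_integralD //; last 4 first.
- by move=> w _; rewrite lee_fin.
- exact/measurable_EFinP.
- by move=> w _; rewrite lee_fin max_excess_ge0.
- exact/measurable_EFinP/(measurableT_comp mM).
rewrite (integral_comp_preserving mM); last exact: max_excess_ge0.
rewrite [leRHS]addeC.
under [X in (_ + X <= _)%E]eq_integral do rewrite EFinM.
rewrite ge0_integralZl_EFin //; last 2 first.
- exact/measurable_EFinP/measurable_indic.
- exact: ltW.
rewrite integral_indic // setIT leeD2lE // ge0_fin_numE ?integral_max_excess //.
by apply: integral_ge0.
Qed.

(** The exceptional set is where some orbit average of [f] exceeds [l]; it is the
    increasing union of the sets treated in [measure_max_excess_gt0]. *)
Lemma maximal_inequality : (\int[P]_w (f w)%:E < +oo)%E ->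
  exists B : set T, [/\ measurable B,
    (l%:E * P B <= \int[P]_w (f w)%:E)%E &
    forall w, ~ B w -> forall n, orbit_sum f n w <= l * n%:R].
Proof.
move=> fi; pose A N := [set w | 0 < M N w].
have mA N : measurable (A N) by exact: measurable_max_excess_gt0.
have mU : measurable (\bigcup_N A N) by exact: bigcup_measurable.
exists (\bigcup_N A N); split => //; last first.
  move=> w nB n; rewrite leNgt; apply/negP => h; apply: nB; exists n => //=.
  apply: lt_le_trans (orbit_sum_le_max_excess w (leqnn n)).
  by rewrite subr_gt0.
have ndA : {homo A : n m / (n <= m)%N >-> (n <= m)%O}.
  apply/nondecreasing_seqP => n; apply/subsetPset => w /= h.
  exact: lt_le_trans h (max_excess_leS _ _).
have cv := nondecreasing_cvg_mu (mu := P) mA mU ndA.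
have cv' : ((fun n => l%:E * P (A n)) @ \oo --> l%:E * P (\bigcup_N A N))%E.
  exact: cvgeZl.
rewrite -(cvg_lim _ cv') //; apply: lime_le.
  by apply/cvg_ex; eexists; exact: cv'.
by apply: nearW => n; exact: measure_max_excess_gt0.
Qed.

End bound.
End maximal_inequality.

(** * Truncation to a high level *)

Lemma negligible_small d (T : measurableType d) (R : realType)
    (P : {measure set T -> \bar R}) (N : set T) :
  (forall e : R, 0 < e ->
    exists B, [/\ measurable B, (P B <= e%:E)%E & N `<=` B]) ->
  P.-negligible N.
Proof.
move=> small.
have /choice[B BP] : forall k : nat, exists B,
    [/\ measurable B, (P B <= (k.+1%:R^-1)%:E)%E & N `<=` B].
  by move=> k; apply: small.
exists (\bigcap_k B k); split.
- by apply: bigcapT_measurable => k; have [] := BP k.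
- apply/eqP; rewrite eq_le measure_ge0 andbT; apply/lee_addgt0Pr => e e0.
  rewrite add0e; have [k ke] : exists k : nat, k.+1%:R^-1 < e.
    have [k _ ke] := near_infty_natSinv_lt (PosNum e0).
    by exists k; exact: (ke k (leqnn k)).
  have [mB PB _] := BP k.
  apply: (@le_trans _ _ (P (B k))); last by rewrite (le_trans PB)// lee_fin ltW.
  apply: le_measure; rewrite ?inE //; last by move=> w; apply.
  by apply: bigcapT_measurable => j; have [] := BP j.
- by move=> w Nw k _; have [_ _] := BP k; apply.
Qed.

Section tails.
Context d {T : measurableType d} {R : realType} (P : probability T R).
Context (g h : T -> R).
Hypothesis mg : measurable_fun [set: T] g.
Hypothesis mh : measurable_fun [set: T] h.
Hypothesis h0 : forall w, 0 <= h w.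
Hypothesis hi : (\int[P]_w (h w)%:E < +oo)%E.

Definition restrict_above (c : R) (w : T) : R := h w * \1_[set v | c < g v] w.

Lemma restrict_above_ge0 c w : 0 <= restrict_above c w.
Proof. by rewrite /restrict_above mulr_ge0. Qed.

Lemma measurable_above c : measurable [set v | c < g v].
Proof.
have := mg measurableT (measurable_itv `]c, +oo[).
rewrite setTI; congr measurable.
by apply/seteqP; split => w /=; rewrite in_itv /= andbT.
Qed.

Lemma measurable_restrict_above c : measurable_fun [set: T] (restrict_above c).
Proof.
by apply: measurable_funM => //; exact/measurable_indic/measurable_above.
Qed.

Lemma integral_restrict_above_cvg0 :
  ((fun n : nat => \int[P]_w (restrict_above n%:R w)%:E) @ \oo --> 0)%E.
Proof.
case: (@dominated_convergence _ _ _ P setT measurableT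
  (fun n w => (restrict_above n%:R w)%:E) (fun=> 0%E) (fun w => (h w)%:E));
  last by rewrite integral0.
- by move=> n; apply/measurable_EFinP; exact: measurable_restrict_above.
- exact: measurable_cst.
- apply: aeW => w _; apply: cvg_near_cst.
  near=> n; rewrite /restrict_above indicE memNset ?mulr0 //=.
  apply/negP; rewrite -leNgt; near: n; exact: nbhs_infty_ger.
- apply/integrableP; split; first exact/measurable_EFinP.
  have /eq_integral -> // : {in setT, (fun w => `|(h w)%:E|)%E =1 EFin \o h}.
  by move=> w _; rewrite gee0_abs ?lee_fin.
- apply: aeW => w n _; rewrite gee0_abs ?lee_fin ?restrict_above_ge0 //.
  rewrite /restrict_above ler_piMr // indicE; by case: (_ \in _).
Unshelve. all: by end_near.
Qed.

Lemma integral_restrict_above_small (e : R) : 0 < e ->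
  \forall n \near \oo, (\int[P]_w (restrict_above n%:R w)%:E <= e%:E)%E.
Proof.
move=> e0.
have := integral_restrict_above_cvg0 => /fine_cvgP[fin cv].
have : \forall n \near \oo, fine (\int[P]_w (restrict_above n%:R w)%:E) <= e.
  exact: (cvgr_le _ cv).
apply: filterS2 fin => n fin le_e.
by rewrite -(fineK fin) lee_fin.
Qed.

End tails.

(** * Invertible measure preserving maps and visits to a large set *)

Section mpt.
Context d {T : measurableType d} {R : realType} {P : probability T R}.
Context (theta : invertible_mpt P).

Lemma mpt_inv_preserving E : measurable E ->
  P (mpt_inv theta @^-1` E) = P E.
Proof.
move=> mE; rewrite -(mpt_preserving theta); last first.
  by rewrite -[X in measurable X]setTI; exact: measurable_mpt_inv.
by rewrite -comp_preimage; congr (P _); apply/seteqP; split => w /=;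
  rewrite mpt_funK.
Qed.

Lemma iter_mptK n w : iter n (mpt_inv theta) (iter n theta w) = w.
Proof. by elim: n w => //= n IH w; rewrite -iterS iterSr mpt_funK IH. Qed.

End mpt.

Section recurrence.
Context d {T : measurableType d} {R : realType} (P : probability T R).
Context (tau : T -> T) (mtau : measurable_fun [set: T] tau).
Hypothesis tauP : forall E, measurable E -> P (tau @^-1` E) = P E.
Hypothesis ergodic_tau : forall E, measurable E -> tau @^-1` E = E ->
  P E = 0%E \/ P E = 1%E.

(** The additive error [m] may depend on the point, which makes the set invariant
    under [tau]. *)
Definition half_avoids (A : set T) : set T :=
  [set w | exists m : nat, forall n,
    orbit_sum tau (\1_A : T -> R) n w <= n%:R / 2 + m%:R].

Lemma measurable_half_avoids A : measurable A -> measurable (half_avoids A).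
Proof.
move=> mA.
have -> : half_avoids A = \bigcup_m \bigcap_n
    [set w | orbit_sum tau (\1_A : T -> R) n w <= n%:R / 2 + m%:R].
  apply/seteqP; split => w /=.
    by move=> [m H]; exists m => // n _; exact: H.
  by move=> [m _ H]; exists m => n; exact: H.
apply: bigcupT_measurable => m; apply: bigcapT_measurable => n.
have mS : measurable_fun [set: T] (orbit_sum tau (\1_A : T -> R) n).
  exact: measurable_orbit_sum (measurable_indic mA).
have := mS measurableT _ (measurable_itv `]-oo, n%:R / 2 + m%:R]).
by rewrite setTI.
Qed.

Lemma half_avoids_invariant A : tau @^-1` half_avoids A = half_avoids A.
Proof.
have ind w : 0 <= (\1_A w : R) <= 1.
  by rewrite indicE; case: (_ \in _); rewrite /= ?lexx ?ler01.
apply/seteqP; split => w /= -[m H].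
  exists m.+1 => -[|n].
    by rewrite /orbit_sum big_ord0 mul0r add0r.
  rewrite orbit_sumS; have := H n; have := ind w.
  rewrite -(natr1 n) -(natr1 m).
  move: (orbit_sum _ _ _ _) (\1_A w) => a b; lra.
exists m.+1 => n; have := H n.+1; have := ind w.
rewrite orbit_sumS -(natr1 n) -(natr1 m).
move: (orbit_sum _ _ _ _) (\1_A w) => a b; lra.
Qed.

(** By the maximal inequality the averages of [\1_A] stay below 1/2 on a set of
    positive measure, and ergodicity spreads this to almost every point. *)
Lemma half_avoids_full A : measurable A -> (P A < (2^-1)%:E)%E ->
  P (half_avoids A) = 1%E.
Proof.
move=> mA PA; have mH := measurable_half_avoids mA.
have PAi : (\int[P]_w ((\1_A : T -> R) w)%:E = P A)%E.
  by rewrite integral_indic // setIT.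
have [||||B [mB PB avg]] := @maximal_inequality _ _ _ P tau mtau tauP
    (\1_A : T -> R) 2^-1.
- exact: measurable_indic.
- by move=> w; rewrite indicE.
- by rewrite invr_gt0.
- by rewrite PAi (lt_trans PA) // ltry.
have [] // := ergodic_tau mH (half_avoids_invariant A) => PH.
exfalso; move: PB; rewrite PAi => PB.
have : P (~` B) = 0%E.
  apply: (subset_measure0 _ mH _ PH); first exact: measurableC.
  by move=> w nB; exists 0 => n; rewrite addr0 mulrC; exact: avg.
have finB : P B \is a fin_num by exact: fin_num_measure.
rewrite probability_setC // -(fineK finB) -EFinB => -[PB1].
move: PB; rewrite -(fineK finB) (_ : fine (P B) = 1); last by lra.
by rewrite -EFinM mulr1 => /le_lt_trans/(_ PA); rewrite ltxx.
Qed.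

End recurrence.

(** * Sublinear growth from one-sided integrable increments *)

Section temperedness.
Context d {T : measurableType d} {R : realType} {P : probability T R}.
Context (theta : invertible_mpt P) (g h : T -> R).
Hypothesis mg : measurable_fun [set: T] g.
Hypothesis mh : measurable_fun [set: T] h.
Hypothesis g0 : forall w, 0 <= g w.
Hypothesis h0 : forall w, 0 <= h w.
Hypothesis hi : (\int[P]_w (h w)%:E < +oo)%E.
Hypothesis gh : forall w, g w <= g (theta w) + h w.

Let hC c := restrict_above g h c.
Let gC c w := Num.max 0 (g w - c).

(** Where [g <= c] the truncation [gC c] vanishes, so it inherits the step
    inequality of [g] with the increment [h] cut down to [[set g > c]], whose
    integral is small for large [c]. *)
Lemma excess_step c w : gC c w <= gC c (theta w) + hC c w.
Proof.
rewrite /gC /hC /restrict_above indicE ge_max; apply/andP; split.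
  by rewrite addr_ge0 ?le_max ?lexx // mulr_ge0.
have [cg|gc] := ltP c (g w).
  rewrite mem_set //= mulr1; apply: (@le_trans _ _ (g (theta w) - c + h w)).
    by have := gh w; lra.
  by rewrite lerD2r le_max lexx orbT.
apply: (@le_trans _ _ 0); first by rewrite subr_le0.
by rewrite addr_ge0 ?le_max ?lexx // mulr_ge0.
Qed.

Lemma excess_iter c n w :
  gC c w <= gC c (iter n theta w) + orbit_sum theta (hC c) n w.
Proof.
elim: n w => [|n IH] w; first by rewrite /orbit_sum big_ord0 addr0.
rewrite orbit_sumS iterSr; have := IH (theta w); have := excess_step c w.
move: (gC c w) (gC c (theta w)) (gC c _) (hC c w) (orbit_sum _ _ _ _).
move=> *; lra.
Qed.

Lemma excess_inv_iter c n w :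
  gC c (iter n (mpt_inv theta) w) <=
    gC c w + orbit_sum (mpt_inv theta) (hC c) n.+1 w.
Proof.
elim: n => [|n IH].
  by rewrite /= lerDl /orbit_sum sumr_ge0 // => i _; exact: restrict_above_ge0.
have := excess_step c (iter n.+1 (mpt_inv theta) w).
rewrite /= mpt_invK /orbit_sum big_ord_recr /= -/(orbit_sum _ _ n.+1 w).
rewrite -/(orbit_sum (mpt_inv theta) (hC c) n.+1 w).
move: IH; rewrite /=.
move: (gC _ _) (gC _ _) (gC _ _) (hC _ _) (orbit_sum _ _ _ _) => *; lra.
Qed.

Lemma le_add_excess c w : g w <= c + gC c w.
Proof. by rewrite -lerBlDl le_max lexx orbT. Qed.

Lemma orbit_sum_ge0 tau (f : T -> R) n w : (forall v, 0 <= f v) ->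
  0 <= orbit_sum tau f n w.
Proof. by move=> f0; rewrite /orbit_sum sumr_ge0. Qed.

Lemma orbit_sum_tail tau (f : T -> R) n m w :
  orbit_sum tau f (n + m) w =
    orbit_sum tau f n w + orbit_sum tau f m (iter n tau w).
Proof.
elim: n w => [|n IH] w; first by rewrite /orbit_sum big_ord0 add0r.
by rewrite addSn !orbit_sumS IH addrA iterSr.
Qed.

(** Forward in time: if the orbit is in [[set g <= c]] at least two thirds of
    every initial segment then it visits that set between [n] and [2 n]; from
    there [g] is propagated backwards to time [n]. *)
Lemma forward_bound c e n w : 0 <= c -> 0 <= e ->
  (forall n, orbit_sum theta (hC c) n w <= e * n%:R) ->
  (forall n, orbit_sum theta (restrict_above g (fun=> 1) c) n w
     <= 3^-1 * n%:R) ->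
  (0 < n)%N -> g (iter n theta w) <= c + 2 * e * n%:R.
Proof.
move=> c0 e0 avg_h avg_1 n0.
have n0R : (0 : R) < n%:R by rewrite ltr0n.
have [k kn gk] : exists2 k, (k < n)%N & g (iter (n + k) theta w) <= c.
  apply: contrapT => none.
  have := avg_1 (n + n)%N; rewrite orbit_sum_tail.
  have -> : orbit_sum theta (restrict_above g (fun=> 1) c) n (iter n theta w)
      = n%:R.
    rewrite /orbit_sum (eq_bigr (fun=> 1)) ?sumr_const ?card_ord // => i _.
    rewrite /restrict_above mul1r indicE mem_set //= ltNge.
    by apply/negP => le_c; apply: none; exists i => //; rewrite addnC iterD.
  have := @orbit_sum_ge0 theta _ n w
    (@restrict_above_ge0 _ _ _ g (fun=> 1) (fun=> ler01) c).
  rewrite natrD; move: (orbit_sum _ _ _ _) => a; lra.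
have := excess_iter c k (iter n theta w).
rewrite -iterD addnC; have -> : gC c (iter (n + k) theta w) = 0.
  by apply/max_idPl; rewrite subr_le0.
have := le_add_excess c (iter n theta w).
have := avg_h (n + k)%N; rewrite orbit_sum_tail.
have := @orbit_sum_ge0 theta _ n w (restrict_above_ge0 g h0 c).
have : e * (n + k)%:R <= 2 * e * n%:R.
  rewrite natrD mulrDr (mulrC 2) -mulrA (mulrC 2) mulrA.
  rewrite mulr2n mulrDr mulr1 lerD2l ler_wpM2l // ler_nat; exact: ltnW.
rewrite -/(hC c).
move: (g _) (gC _ _) (orbit_sum _ _ _ _) (orbit_sum _ _ _ _) => *; lra.
Qed.

(** The integral of [f * \1_(g > c)] vanishes as [c] grows, so the exceptional
    set of the maximal inequality becomes small for any fixed threshold [l]. *)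
Lemma small_averages (tau : T -> T) (f : T -> R) (l e : R) :
  measurable_fun [set: T] tau ->
  (forall E, measurable E -> P (tau @^-1` E) = P E) ->
  measurable_fun [set: T] f -> (forall w, 0 <= f w) ->
  (\int[P]_w (f w)%:E < +oo)%E -> 0 < l -> 0 < e ->
  \forall c \near \oo, exists B, [/\ measurable B, (P B <= e%:E)%E &
    forall w, ~ B w -> forall n,
      orbit_sum tau (restrict_above g f c%:R) n w <= l * n%:R].
Proof.
move=> mtau tauP mf f0 fi l0 e0.
have le0 : 0 < l * e by rewrite mulr_gt0.
have := integral_restrict_above_small mg mf f0 fi le0.
apply: filterS => c le_c.
have [||||B [mB PB avg]] := @maximal_inequality _ _ _ P tau mtau tauP
    (restrict_above g f c%:R) l.
- exact: measurable_restrict_above.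
- exact: restrict_above_ge0.
- exact: l0.
- by apply: le_lt_trans le_c _; rewrite ltry.
exists B; split => //.
have := le_trans PB le_c; rewrite EFinM lee_pmul2l ?lte_fin //.
Qed.

(* The threshold 1/3 for [\1_(g > c)] guarantees the visits to [[set g <= c]]
   that [forward_bound] starts from. *)
Lemma ae_forward_bound (e : R) : 0 < e -> P.-negligible
  [set w | ~ exists c, forall n, g (iter n theta w) <= c + e * n%:R].
Proof.
move=> e0; apply: negligible_small => dl dl0.
have dl20 : 0 < dl / 2 by rewrite divr_gt0.
have mth := measurable_mpt_fun theta; have thP := mpt_preserving theta.
have e20 : 0 < e / 2 by rewrite divr_gt0.
have thr0 : 0 < 3^-1 :> R by rewrite invr_gt0.
have i1 : (\int[P]_w ((fun=> 1) w)%:E < +oo)%E.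
  by rewrite integral_cst // mul1e (le_lt_trans (probability_le1 _ _)) ?ltry.
near \oo => c.
have [B1 [mB1 PB1 avg1]] : exists B, [/\ measurable B,
    (P B <= (dl / 2)%:E)%E & forall w, ~ B w -> forall n,
      orbit_sum theta (restrict_above g h c%:R) n w <= e / 2 * n%:R].
  by near: c; exact: (small_averages mth).
have [B2 [mB2 PB2 avg2]] : exists B, [/\ measurable B,
    (P B <= (dl / 2)%:E)%E & forall w, ~ B w -> forall n,
      orbit_sum theta (restrict_above g (fun=> 1) c%:R) n w <= 3^-1 * n%:R].
  by near: c; exact: (small_averages mth).
exists (B1 `|` B2); split; first exact: measurableU.
  apply: le_trans (measureU2 _ mB1 mB2) _.
  by rewrite (splitr dl) EFinD leeD.
move=> w; apply: contra_notP => /not_orP[nB1 nB2].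
exists (c%:R + g w) => -[|n]; first by rewrite mulr0 addr0 /= lerDr.
have := @forward_bound c%:R (e / 2) n.+1 w (ler0n _ _) (ltW e20)
  (avg1 _ nB1) (avg2 _ nB2) isT.
rewrite mulrCA mulfV // mulr1; have := g0 w; lra.
Unshelve. all: by end_near.
Qed.

Lemma ae_backward_bound (e : R) : 0 < e -> P.-negligible
  [set w | ~ exists c, forall n,
    g (iter n (mpt_inv theta) w) <= c + e * n%:R].
Proof.
move=> e0; apply: negligible_small => dl dl0.
have mth := measurable_mpt_inv theta; have thP := mpt_inv_preserving theta.
near \oo => c.
have [B [mB PB avg]] : exists B, [/\ measurable B,
    (P B <= dl%:E)%E & forall w, ~ B w -> forall n,
      orbit_sum (mpt_inv theta) (restrict_above g h c%:R) n w <= e * n%:R].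
  by near: c; exact: (small_averages mth).
exists B; split => // w; apply: contra_notP => nB.
exists (c%:R + gC c%:R w + e) => n.
have := avg _ nB n.+1; have := excess_inv_iter c%:R n w.
have := le_add_excess c%:R (iter n (mpt_inv theta) w).
rewrite -natr1 mulrDr mulr1 -/(hC _).
move: (gC _ _) (gC _ _) (orbit_sum _ _ _ _) => *; lra.
Unshelve. all: by end_near.
Qed.

End temperedness.

Lemma cvg_sublinear (R : realType) (u : nat -> R) :
  (forall n, 0 <= u n) ->
  (forall k : nat, exists c, forall n, u n <= c + k.+1%:R^-1 * n%:R) ->
  (fun n => u n / n%:R) @ \oo --> (0 : R).
Proof.
move=> u0 sub; apply/cvgrPdist_le => e e0.
have [k ke] : exists k : nat, k.+1%:R^-1 < e / 2.
  have e20 : 0 < e / 2 by rewrite divr_gt0.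
  have [k _ ke] := near_infty_natSinv_lt (PosNum e20).
  by exists k; exact: (ke k (leqnn k)).
have [c uc] := sub k; near=> n.
have n0 : (0 : R) < n%:R by rewrite ltr0n; near: n; exists 1%N.
rewrite sub0r normrN ger0_norm ?divr_ge0 //.
rewrite ler_pdivrMr //; apply: (le_trans (uc n)).
have : c <= e / 2 * n%:R.
  rewrite -ler_pdivrMl ?divr_gt0 //; near: n; exact: nbhs_infty_ger.
have : k.+1%:R^-1 * n%:R <= e / 2 * n%:R by rewrite ler_pM2r // ltW.
rewrite {3}(splitr e) mulrDl; move: (_^-1 * _) (e / 2 * _) => *; lra.
Unshelve. all: by end_near.
Qed.

Lemma mpt_iterN d (T : measurableType d) (R : realType) (P : probability T R)
    (theta : invertible_mpt P) n w :
  mpt_iter theta (- n%:Z) w = iter n (mpt_inv theta) w.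
Proof. by case: n. Qed.

(** Only an upper bound for [ln K - ln K \o theta] is assumed: the recurrence of
    the sets [[set ln K <= c]] supplies the control that a lower bound would
    give. *)
Lemma tempered_of_step d (T : measurableType d) (R : realType)
    (P : probability T R) (theta : invertible_mpt P) (K h : T -> R) :
  measurable_fun [set: T] K -> (forall w, 1 <= K w) ->
  measurable_fun [set: T] h -> (forall w, 0 <= h w) ->
  (\int[P]_w (h w)%:E < +oo)%E ->
  (forall w, ln (K w) <= ln (K (theta w)) + h w) -> tempered theta K.
Proof.
move=> mK K1 mh h0 hi step; pose g w := ln (K w).
have mg : measurable_fun [set: T] g by exact: measurableT_comp.
have g0 w : 0 <= g w by exact: ln_ge0.
pose NF k := [set w | ~ exists c, forall n,
  g (iter n theta w) <= c + k.+1%:R^-1 * n%:R].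
pose NB k := [set w | ~ exists c, forall n,
  g (iter n (mpt_inv theta) w) <= c + k.+1%:R^-1 * n%:R].
have neg : P.-negligible (\bigcup_k (NF k `|` NB k)).
  apply: negligible_bigcup => k; apply: negligibleU.
    by apply: (@ae_forward_bound _ _ _ _ theta g h) => //; rewrite invr_gt0.
  by apply: (@ae_backward_bound _ _ _ _ theta g h) => //; rewrite invr_gt0.
apply: negligibleS neg => w; apply: contra_notP => good; split.
  apply: (@cvg_sublinear _ (fun n => g (iter n theta w))) => // k.
  by apply: contrapT => bad; apply: good; exists k => //; left.
have cv : (fun n => g (iter n (mpt_inv theta) w) / n%:R) @ \oo --> (0 : R).
  apply: (@cvg_sublinear _ (fun n => g (iter n (mpt_inv theta) w))) => // k.
  by apply: contrapT => bad; apply: good; exists k => //; right.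
rewrite (_ : (fun n => _) =
    (fun n => - (g (iter n (mpt_inv theta) w) / n%:R))).
  by rewrite -[X in _ --> X]oppr0; exact: cvgN.
by apply/funext => n; rewrite mpt_iterN /g invrN mulrN.
Qed.

(** * Exponential decay from a summation bound *)

Section decay.
Context {R : realType}.

(** With [psi n] the sum of the first [n] terms [1 / (z k * a k)], the hypothesis
    reads [a n <= D / psi n], so that [psi n.+1 >= psi n * (1 + 1 / (D * z n))]:
    [psi] grows by a fixed factor whenever [z n <= D]. *)
Lemma decay_of_summed_bound (a z b : nat -> R) (D m : R) : 0 < D ->
  (forall k, 0 < z k) -> (forall k, 0 <= a k) ->
  (forall k, a k = 0 -> a k.+1 = 0) ->
  (forall k, b k = 1 \/ b k = 0 /\ z k <= D) ->
  (forall n : nat, \sum_(k < n) b k <= n%:R / 2 + m) ->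
  (forall n : nat, a n * \sum_(k < n) (z k * a k)^-1 <= D) ->
  let al := ln (1 + (D * D)^-1) / 2 in
  forall n : nat,
    a n <= (1 + D * z 0%N * expR (2 * al * (m + 1))) * a 0%N * expR (- al * n%:R).
Proof.
move=> D0 z0 a0 aS bz sumb summed al n.
have DD0 : 0 < (D * D)^-1 by rewrite invr_gt0 mulr_gt0.
have al2 : expR (2 * al) = 1 + (D * D)^-1.
  by rewrite /al mulrC divfK // lnK // posrE addr_gt0.
have al0 : 0 <= al by rewrite divr_ge0 // ln_ge0 // lerDl ltW.
have c0 : 0 <= D * z 0%N * expR (2 * al * (m + 1)).
  by rewrite !mulr_ge0 ?expR_ge0 // ltW.
case: n => [|n].
  by rewrite mulr0 expR0 mulr1 ler_peMl // lerDl.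
have [an0|/eqP an0] := eqVneq (a n.+1) 0.
  by rewrite an0 !mulr_ge0 ?expR_ge0 ?addr_ge0.
have apos k : (k <= n.+1)%N -> 0 < a k.
  move=> kn; rewrite lt_neqAle a0 andbT eq_sym; apply/eqP => ak0; apply: an0.
  rewrite -(subnK kn); elim: (_ - _)%N => [|j IH]; rewrite ?add0n // addSn.
  exact: aS.
pose psi j := \sum_(k < j) (z k * a k)^-1.
pose t j := j%:R - \sum_(k < j) b k.
have grow j : (j <= n)%N ->
    expR (2 * al * (t j.+1 - 1)) * (z 0%N * a 0%N)^-1 <= psi j.+1.
  elim: j => [|j IH] jn.
    rewrite /psi /t !big_ord1 /= ler_piMl //.
      by rewrite invr_ge0 mulr_ge0 // ltW.
    rewrite -[leRHS]expR0 ler_expR; apply: mulr_ge0_le0.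
      by rewrite mulr_ge0.
    have [->|[-> _]] := bz 0%N; lra.
  have {}IH := IH (ltnW jn).
  have pj : 0 < psi j.+1.
    apply: lt_le_trans IH; rewrite mulr_gt0 ?expR_gt0 // invr_gt0 mulr_gt0 //.
    exact: apos.
  have step : psi j.+1 * (1 + (D * z j.+1)^-1) <= psi j.+2.
    rewrite mulrDr mulr1 [leRHS]big_ord_recr /= -/(psi j.+1) lerD2l.
    rewrite !invfM mulrA [leRHS]mulrC ler_wpM2r ?invr_ge0 //; first exact: ltW.
    rewrite ler_pdivrMr // mulrC ler_pdivlMr ?apos // 1?ltnW //.
    by rewrite mulrC summed.
  have Z0 : 0 < (D * z j.+1)^-1 by rewrite invr_gt0 mulr_gt0.
  have [bj|[bj zj]] := bz j.+1.
    have -> : t j.+2 = t j.+1 by rewrite /t big_ord_recr /= bj -(natr1 j.+1); lra.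
    apply: (le_trans IH); apply: le_trans step.
    by rewrite ler_peMr ?ltW // ltrDl.
  have -> : t j.+2 - 1 = 1 + (t j.+1 - 1).
    rewrite /t big_ord_recr /= bj -(natr1 j.+1); lra.
  rewrite mulrDr mulr1 expRD al2 -mulrA mulrC.
  apply: le_trans step; apply: ler_pM => //.
  - by rewrite mulr_ge0 ?expR_ge0 // invr_ge0 mulr_ge0 // ltW.
  - by rewrite addr_ge0 // ltW.
  - by rewrite lerD2l lef_pV2 ?posrE ?mulr_gt0 // ler_pM2l.
have pn := grow n (leqnn n).
have an : a n.+1 <= D / psi n.+1.
  rewrite ler_pdivlMr ?summed //; apply: lt_le_trans pn.
  by rewrite mulr_gt0 ?expR_gt0 // invr_gt0 mulr_gt0 // apos.
apply: (le_trans an).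
have tn : n.+1%:R / 2 - m <= t n.+1.
  by have := sumb n.+1; rewrite /t; lra.
have zpos : 0 < (z 0%N * a 0%N)^-1 by rewrite invr_gt0 mulr_gt0 // apos.
have low : expR (2 * al * (n.+1%:R / 2 - m - 1)) * (z 0%N * a 0%N)^-1
    <= psi n.+1.
  apply: le_trans pn; rewrite ler_pM2r // ler_expR; apply: ler_wpM2l.
    by rewrite mulr_ge0.
  by rewrite lerD2r.
apply: (@le_trans _ _ (D / (expR (2 * al * (n.+1%:R / 2 - m - 1)) *
    (z 0%N * a 0%N)^-1))).
  rewrite ler_pM2l // lef_pV2 ?posrE //; last by rewrite mulr_gt0 ?expR_gt0.
  by apply: lt_le_trans low; rewrite mulr_gt0 ?expR_gt0.
rewrite invfM invrK -expRN.
have -> : - (2 * al * (n.+1%:R / 2 - m - 1)) =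
    2 * al * (m + 1) + - al * n.+1%:R by lra.
rewrite expRD.
have -> : D * (expR (2 * al * (m + 1)) * expR (- al * n.+1%:R) *
    (z 0%N * a 0%N)) = D * z 0%N * expR (2 * al * (m + 1)) * a 0%N *
    expR (- al * n.+1%:R) by ring.
by rewrite ler_wpM2r ?expR_ge0 // ler_wpM2r // lerDr.
Qed.

End decay.

(** * Operator norms and measurability *)

Section operator_norm.
Context {R : realType} {X : normedModType R}.

Lemma opnorm_leP (F : X -> X) (c : R) : (forall a x, F (a *: x) = a *: F x) ->
  0 <= c -> (opnorm F <= c%:E)%E <-> forall x, `|F x| <= c * `|x|.
Proof.
move=> FZ c0; split => [Fc x|Fc]; last first.
  apply: ge_ereal_sup => _ [x /= x1 <-]; rewrite lee_fin.
  by rewrite (le_trans (Fc x)) // ler_piMr.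
have [->|x0] := eqVneq x 0.
  have -> : F 0 = 0 by have := FZ 0 0; rewrite !scale0r.
  by rewrite !normr0 mulr0.
have nx0 : 0 < `|x| by rewrite normr_gt0.
have : ((`|F (`|x|^-1 *: x)|)%:E <= opnorm F)%E.
  apply: ereal_sup_ubound; exists (`|x|^-1 *: x) => //=.
  by rewrite normrZ normfV normr_id mulVf // gt_eqF.
move=> /le_trans/(_ Fc); rewrite lee_fin FZ normrZ normfV normr_id.
by rewrite ler_pdivrMl // mulrC.
Qed.

Lemma opnorm_ge0 (F : X -> X) : (0 <= opnorm F)%E.
Proof.
apply: (@le_trans _ _ (`|F 0|)%:E); first by rewrite lee_fin.
by apply: ereal_sup_ubound; exists 0 => //=; rewrite normr0.
Qed.

Lemma bounded_op_bound (A : bounded_op X) :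
  exists2 c : R, 0 <= c & forall x, `|A x| <= c * `|x|.
Proof.
have /linear_bounded_continuous/linear_boundedP := @bounded_op_continuous _ _ A.
move=> /pinfty_ex_gt0[c c0 cP]; exists c => //; exact: ltW.
Qed.

Lemma opnorm_fin_num (A : bounded_op X) : opnorm A \is a fin_num.
Proof.
have [c c0 cP] := bounded_op_bound A.
rewrite ge0_fin_numE ?opnorm_ge0 //.
apply: le_lt_trans (ltry c); apply/opnorm_leP => // a x; exact: linearZ.
Qed.

Lemma bounded_opE (A : bounded_op X) x : `|A x| <= fine (opnorm A) * `|x|.
Proof.
move: x; apply/opnorm_leP; first by move=> a x; exact: linearZ.
  exact/fine_ge0/opnorm_ge0.
by rewrite fineK ?opnorm_fin_num.
Qed.

Lemma separable_dense_seq : separable X ->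
  exists e : nat -> X, dense (range e).
Proof.
move=> [D cD dD]; have /ppcard_leP[f] := cD.
have /choice[e eP] : forall n : nat, exists x, forall y, D y -> f y = n -> y = x.
  move=> n; have [[x [Dx fx]]|none] := pselect (exists x, D x /\ f x = n).
    exists x => y Dy fy; have := @inj _ _ _ f y x; rewrite !inE.
    by move=> /(_ Dy Dx); apply; exact: etrans fy (esym fx).
  by exists 0 => y Dy fy; exfalso; apply: none; exists y.
exists e => O O0 oO; have [x [Ox Dx]] := dD O O0 oO.
by exists x; split => //; exists (f x) => //; exact/esym/eP.
Qed.

(** Scaling by [max 1 |x|] instead of restricting to the unit ball expresses the
    operator norm as a supremum over any dense sequence. *)
Lemma opnorm_dense (e : nat -> X) (F : X -> X) : dense (range e) ->
  (forall a x, F (a *: x) = a *: F x) -> continuous F ->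
  opnorm F = ereal_sup (range (fun n => (`|F (e n)| / Num.max 1 `|e n|)%:E)).
Proof.
move=> de FZ cF; apply/eqP; rewrite eq_le; apply/andP; split.
  apply: ge_ereal_sup => _ [x /= x1 <-].
  apply/lee_addgt0Pr => eps eps0.
  pose phi y := `|F y| / Num.max 1 `|y|.
  have mx0 (y : X) : 0 < Num.max 1 `|y| by rewrite lt_max ltr01.
  have cphi : continuous phi.
    move=> y; apply: cvgM.
      by apply: cvg_norm; exact: cF.
    apply: cvgV; first by rewrite gt_eqF.
    exact: (@continuous_max _ _ (fun=> 1) (fun y => `|y|) y (cvg_cst _)
      (@norm_continuous _ _ y)).
  have oU : open (phi @^-1` `]phi x - eps, +oo[).
    by have /continuousP := cphi; apply; exact: interval_open.
  have [|y [/= Ue [n _ en]]] := de _ _ oU.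
    by exists x; rewrite /= in_itv /= andbT ltrBlDr ltrDl.
  rewrite in_itv /= andbT -en in Ue.
  apply: (@le_trans _ _ ((phi (e n))%:E + eps%:E)%E).
    rewrite -EFinD lee_fin -lerBlDr (le_trans _ (ltW Ue)) // lerD2r.
    by rewrite /phi (max_l x1) divr1.
  by rewrite leeD2r //; apply: ereal_sup_ubound; exists n.
apply: ge_ereal_sup => _ [n _ <-]; apply: ereal_sup_ubound.
have m0 : 0 < Num.max 1 `|e n| by rewrite lt_max ltr01.
exists ((Num.max 1 `|e n|)^-1 *: e n) => /=.
  by rewrite normrZ normfV gtr0_norm // ler_pdivrMl // mulr1 le_max lexx orbT.
by rewrite FZ normrZ normfV gtr0_norm // mulrC.
Qed.

Lemma continuous_of_linear_bound (F : X -> X) (c : R) :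
  (forall a x y, F (a *: x + y) = a *: F x + F y) ->
  (forall x, `|F x| <= c * `|x|) -> continuous F.
Proof.
move=> Flin Fc.
pose L := GRing.isLinear.Build _ _ _ _ F Flin.
pose G : {linear X -> X} := HB.pack F L.
apply/(@linear_bounded_continuous _ _ _ G)/linear_boundedP.
near=> r => x; apply: (le_trans (Fc x)); rewrite ler_wpM2r //.
Unshelve. all: by end_near.
Qed.

End operator_norm.

Section measurability.
Context d {T : measurableType d} {R : realType}.

Lemma measurable_ereal_sup_range (D : set T) (f : nat -> T -> \bar R) :
  (forall n, measurable_fun D (f n)) ->
  measurable_fun D (fun w => ereal_sup (range (fun n => f n w))).
Proof.
move=> mf; have := measurable_fun_esups mf 0.
rewrite /esups /sdrop; congr measurable_fun; apply/funext => w.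
by congr (ereal_sup (_ @` _)); apply/seteqP; split.
Qed.

Lemma measurable_borel_comp (X Y : ptopologicalType) (D : set T)
    (f : T -> X) (c : X -> Y) : continuous c ->
  measurable_fun D (f : T -> borel X) ->
  measurable_fun D (c \o f : T -> borel Y).
Proof.
move=> cc mf mD; move: (mD).
apply: (@measurability _ _ T (borel Y) D (c \o f) (@open Y)) => //.
move=> _ [B oB <-]; rewrite comp_preimage; apply: mf => //.
by apply: sub_sigma_algebra; move/continuousP: cc; apply.
Qed.

Lemma measurable_borel_real (X : ptopologicalType) (D : set T)
    (f : T -> X) (c : X -> R) : continuous c ->
  measurable_fun D (f : T -> borel X) -> measurable_fun D (c \o f).
Proof.
move=> cc mf mD; apply: (measurability _ (RGenOpens.measurableE R)) => //.
move=> _ [_ [x [y ->]] <-]; rewrite comp_preimage; apply: mf => //.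
apply: sub_sigma_algebra; move/continuousP: cc; apply.
exact: interval_open.
Qed.

Lemma measurable_opnorm (X : normedModType R) (D : set T) (F : T -> X -> X) :
  separable X -> (forall x, measurable_fun D (fun w => F w x : borel X)) ->
  (forall w, D w -> forall a x, F w (a *: x) = a *: F w x) ->
  (forall w, D w -> continuous (F w)) ->
  measurable_fun D (fun w => opnorm (F w)).
Proof.
move=> /separable_dense_seq[e de] mF FZ cF.
apply: (@eq_measurable_fun _ _ _ _ _ (fun w => ereal_sup (range
    (fun n => (`|F w (e n)| / Num.max 1 `|e n|)%:E)))).
  move=> w; rewrite inE => Dw.
  by rewrite (opnorm_dense de (FZ w Dw) (cF w Dw)).
apply: measurable_ereal_sup_range => n; apply/measurable_EFinP.
apply: measurable_funM => //.
exact: (measurable_borel_real (@norm_continuous _ X) (mF (e n))).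
Qed.

End measurability.

(** * Bounded solutions and the splitting of the space *)

Section orbits.
Context d {T : measurableType d} {R : realType} {P : probability T R}.
Context (theta : invertible_mpt P).

Lemma NegzS1 n : Negz n.+1 + 1 = Negz n.
Proof. by lia. Qed.

Lemma mpt_iter_mpt (n : int) w :
  mpt_iter theta n (theta w) = mpt_iter theta (n + 1) w.
Proof.
case: n => [n|[|n]]; first by rewrite /= addn1 /= -iterSr.
  by rewrite /= mpt_funK.
by rewrite NegzS1 /mpt_iter iterSr mpt_funK.
Qed.

Context (A : set T).
Hypothesis invA : invariant_set theta A.

Lemma invariant_mpt w : A w -> A (theta w).
Proof. by move=> Aw; rewrite -invA; exists w. Qed.

Lemma invariant_mpt_inv w : A w -> A (mpt_inv theta w).
Proof.
by move=> Aw; move: (Aw); rewrite -{1}invA => -[v Av <-]; rewrite mpt_funK.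
Qed.

Lemma invariant_iter n w : A w -> A (iter n theta w).
Proof. by move=> Aw; elim: n => //= n; exact: invariant_mpt. Qed.

Lemma invariant_iter_inv n w : A w -> A (iter n (mpt_inv theta) w).
Proof. by move=> Aw; elim: n => //= n; exact: invariant_mpt_inv. Qed.

End orbits.

Section two_sided.
Context {X : Type}.

(** Both halves are indexed by the distance to time 0, so that a backward orbit
    [y] can be used as [q] without a shift: [q k] sits at time [- k]. *)
Definition glue (p q : nat -> X) (n : int) : X :=
  match n with Posz k => p k | Negz k => q k.+1 end.

End two_sided.

Section admissible_dynamics.
Context d {T : measurableType d} {R : realType} {P : probability T R}.
Context (theta : invertible_mpt P) {X : completeNormedModType R}.
Context (Phi : nat -> T -> bounded_op X).
Hypothesis cocycle_Phi : measurable_cocycle theta Phi.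

Local Notation inv := (mpt_inv theta).

Lemma cocycle0 w x : Phi 0%N w x = x.
Proof. by case: cocycle_Phi. Qed.

Lemma cocycleD n m w x :
  Phi (n + m)%N w x = Phi m (iter n theta w) (Phi n w x).
Proof. by case: cocycle_Phi. Qed.

Lemma cocycleS n w x : Phi n.+1 w x = Phi 1%N (iter n theta w) (Phi n w x).
Proof. by rewrite -addn1 cocycleD. Qed.

Lemma cocycleSr n w x : Phi n.+1 w x = Phi n (theta w) (Phi 1%N w x).
Proof. by rewrite -add1n cocycleD. Qed.

Definition bounded_seq I (x : I -> X) : Prop :=
  exists M : R, forall n, `|x n| <= M.

Lemma bounded_seq_lin I (x y : I -> X) (a : R) : bounded_seq x -> bounded_seq y ->
  bounded_seq (fun n => a *: x n + y n).
Proof.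
move=> [M xM] [N yN]; exists (`|a| * M + N) => n.
by rewrite (le_trans (ler_normD _ _)) // normrZ lerD // ler_wpM2l.
Qed.

Lemma bounded_glue p q : bounded_seq p -> bounded_seq q -> bounded_seq (glue p q).
Proof.
move=> [M pM] [N qN]; exists (Num.max M N) => -[k|k] /=.
  by rewrite le_max pM.
by rewrite le_max qN orbT.
Qed.

Lemma solution_glue w (f : int -> X) p q :
  (forall n, p n.+1 = Phi 1%N (iter n theta w) (p n) + f n.+1%:Z) ->
  p 0%N = Phi 1%N (inv w) (q 1%N) + f 0 ->
  (forall m, q m.+1 = Phi 1%N (iter m.+2 inv w) (q m.+2) + f (Negz m)) ->
  solution_at theta Phi w f (glue p q).
Proof.
move=> hp h0 hq [n|[|m]]; rewrite /generator.
- by rewrite -PoszD addn1; exact: hp.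
- exact: h0.
- by rewrite NegzS1; exact: hq.
Qed.

Lemma solution_lin w f g x y (a : R) :
  solution_at theta Phi w f x -> solution_at theta Phi w g y ->
  solution_at theta Phi w (fun n => a *: f n + g n) (fun n => a *: x n + y n).
Proof.
move=> hx hy n; rewrite hx hy linearP scalerDr !addrA; congr (_ + _).
by rewrite -!addrA; congr (_ + _); rewrite addrC.
Qed.

Definition impulse (v : X) (n : int) : X := if n == 0 then v else 0.

Context (zeta : T -> R).
Hypothesis zeta0 : forall w, 0 < zeta w.

Definition admissible_bound (c : R) (w : T) : Prop := forall f x (F : R),
  (forall n : int, zeta (mpt_iter theta n w) * `|f n| <= F) ->
  bounded_seq x -> solution_at theta Phi w f x -> forall n, `|x n| <= c * F.

(** Shifting time by one identifies the sequence spaces attached to [w] and to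
    [theta w], so the admissibility constant is an invariant function. *)
Lemma admissible_bound_mpt c w :
  admissible_bound c (theta w) -> admissible_bound c w.
Proof.
move=> H f x F fF [M xM] sol n.
rewrite -[n](subrK 1).
apply: (H (fun k => f (k + 1)) (fun k => x (k + 1)) F).
- by move=> k; rewrite mpt_iter_mpt.
- by exists M.
- by move=> k; rewrite sol mpt_iter_mpt.
Qed.

Lemma admissible_bound_iter c n w :
  admissible_bound c (iter n theta w) -> admissible_bound c w.
Proof.
by elim: n w => //= n IH w; rewrite -iterS iterSr => /IH/admissible_bound_mpt.
Qed.

Definition backward_orbit (w : T) (y : nat -> X) : Prop :=
  forall m, Phi 1%N (iter m.+1 inv w) (y m.+1) = y m.

Lemma backward_orbitD w y n m : backward_orbit w y ->
  Phi m (iter (n + m) inv w) (y (n + m)%N) = y n.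
Proof.
move=> yb; elim: m n => [|m IH] n; first by rewrite addn0 cocycle0.
by rewrite addnS cocycleSr /= mpt_invK yb IH.
Qed.

Context (Ot : set T) (c : R) (green : X -> T -> int -> X).
Hypothesis invariant_Ot : invariant_set theta Ot.
Hypothesis bound_Ot : forall w, Ot w -> admissible_bound c w.
Hypothesis green_bounded : forall v w, Ot w -> bounded_seq (green v w).
Hypothesis green_solution : forall v w, Ot w ->
  solution_at theta Phi w (impulse v) (green v w).

Lemma bounded_solution_unique w f x y : Ot w -> bounded_seq x -> bounded_seq y ->
  solution_at theta Phi w f x -> solution_at theta Phi w f y ->
  forall n, x n = y n.
Proof.
move=> Ow bx bY sx sy n.
have sol := solution_lin (-1) sx sy.
have := bound_Ot Ow (F := 0) _ (bounded_seq_lin (-1) bx bY) sol n.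
rewrite mulr0 normr_le0 scaleN1r addrC subr_eq0 => H; apply/esym/eqP/H => k.
by rewrite scaleN1r addNr normr0 mulr0.
Qed.

Lemma green_lin w a v v' n : Ot w ->
  green (a *: v + v') w n = a *: green v w n + green v' w n.
Proof.
move=> Ow; apply: (@bounded_solution_unique w (impulse (a *: v + v'))
  _ (fun n => a *: green v w n + green v' w n)) => //.
- exact: green_bounded.
- by apply: bounded_seq_lin; exact: green_bounded.
- exact: green_solution.
have := solution_lin a (@green_solution v w Ow) (@green_solution v' w Ow).
by congr solution_at; apply/funext => k; rewrite /impulse; case: ifP => //;
  rewrite scaler0 addr0.
Qed.

Lemma green_le w v n : Ot w -> `|green v w n| <= c * (zeta w * `|v|).
Proof.
move=> Ow; apply: (bound_Ot Ow _ (green_bounded v Ow) (green_solution v Ow)).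
move=> k; rewrite /impulse; case: eqP => [->|_] //.
by rewrite normr0 mulr0 mulr_ge0 // ltW.
Qed.

Lemma green_posz w v n : Ot w -> green v w n%:Z = Phi n w (green v w 0).
Proof.
move=> Ow; elim: n => [|n IH]; first by rewrite cocycle0.
have := green_solution v Ow n%:Z.
by rewrite -PoszD addn1 /impulse /= addr0 IH cocycleS.
Qed.

(** At time 0 the equation for the impulse says that [green v w 0 - v] is the
    image of the value at time [- 1]; so at negative times the solution is a
    backward orbit of the unstable component [v - green v w 0] with the opposite
    sign. *)
Definition back (v : X) (w : T) (m : nat) : X :=
  if m is m'.+1 then - green v w (Negz m') else v - green v w 0.

Lemma back_backward_orbit w v : Ot w -> backward_orbit w (back v w).
Proof.
move=> Ow [|m] /=.
  have := green_solution v Ow (Negz 0); rewrite /impulse /generator /= => ->.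
  by rewrite linearN opprD addrCA subrr addr0.
have := green_solution v Ow (Negz m.+1).
rewrite NegzS1 /impulse /generator /=.
by move=> ->; rewrite addr0 linearN.
Qed.

Lemma back_bounded w v : Ot w -> bounded_seq (back v w).
Proof.
move=> Ow; have [M gM] := green_bounded v Ow; exists (`|v| + M) => -[|m] /=.
  by rewrite (le_trans (ler_normB _ _)) // lerD2l.
by rewrite normrN (le_trans (gM _)) // lerDr.
Qed.

(** A bounded forward orbit, extended by 0 to negative times, is itself the
    bounded solution driven by the impulse [v]. *)
Lemma green_of_bounded_forward w v : Ot w -> bounded_seq (fun n => Phi n w v) ->
  green v w 0 = v.
Proof.
move=> Ow bv.
rewrite (@bounded_solution_unique w (impulse v) _
  (glue (fun n => Phi n w v) (fun=> 0)) Ow) //=; first by rewrite cocycle0.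
- exact: green_bounded.
- by apply: bounded_glue => //; exists 0 => n; rewrite normr0.
- exact: green_solution.
- apply: solution_glue => [n||m]; rewrite /impulse /= ?linear0 ?addr0 ?add0r //.
    by rewrite cocycleS.
  exact: cocycle0.
Qed.

(** Likewise a negated bounded backward orbit, extended by 0 to nonnegative
    times. *)
Lemma green_of_bounded_backward w y : Ot w -> bounded_seq y ->
  backward_orbit w y ->
  green (y 0%N) w 0 = 0 /\ forall m, back (y 0%N) w m = y m.
Proof.
move=> Ow [M yM] yb.
have E : forall n, green (y 0%N) w n = glue (fun=> 0) (fun m => - y m) n.
  apply: (@bounded_solution_unique w (impulse (y 0%N)) _ _ Ow).
  - exact: green_bounded.
  - apply: bounded_glue; first by exists 0 => n; rewrite normr0.
    by exists M => n; rewrite normrN.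
  - exact: green_solution.
  - apply: solution_glue => [n||m]; rewrite /impulse /= ?linear0 ?addr0 //.
      by rewrite linearN (yb 0%N) addNr.
    by rewrite linearN (yb m.+1).
split; first exact: E.
by case=> [|m] /=; rewrite E /= ?subr0 ?opprK.
Qed.

Lemma green_idem w v : Ot w -> green (green v w 0) w 0 = green v w 0.
Proof.
move=> Ow; apply: green_of_bounded_forward => //.
by have [M gM] := green_bounded v Ow; exists M => n; rewrite -green_posz.
Qed.

Lemma back_unique w v y : Ot w -> bounded_seq y -> backward_orbit w y ->
  y 0%N = v - green v w 0 -> forall m, back v w m = y m.
Proof.
move=> Ow yM yb y0 m.
have [_ <-] := green_of_bounded_backward Ow yM yb.
have [_ <-] := green_of_bounded_backward Ow (back_bounded v Ow)
  (back_backward_orbit v Ow).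
by rewrite y0.
Qed.

Lemma green_back w v m : Ot w -> green (back v w m) (iter m inv w) 0 = 0.
Proof.
move=> Ow; pose y k := back v w (m + k)%N.
have -> : back v w m = y 0%N by rewrite /y addn0.
have [|||//] := @green_of_bounded_backward (iter m inv w) y.
- exact: invariant_iter_inv.
- by have [M bM] := back_bounded v Ow; exists M => k; exact: bM.
- move=> k; rewrite /y -iterD addSn (addnC k) addnS.
  exact: back_backward_orbit.
Qed.

Lemma green_unstable w v : Ot w -> green (v - green v w 0) w 0 = 0.
Proof. by move=> Ow; exact: (green_back v 0 Ow). Qed.

(* A backward orbit at [theta w], obtained from the one of [v] at [w] by one
   step of the cocycle. *)
Let pushed w v m := if m is m'.+1 then back v w m' else Phi 1%N w (back v w 0).

Let pushed_backward_orbit w v : Ot w -> backward_orbit (theta w) (pushed w v).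
Proof.
move=> Ow [|m]; rewrite iterSr mpt_funK //=.
exact: back_backward_orbit.
Qed.

Let pushed_bounded w v : Ot w -> bounded_seq (pushed w v).
Proof.
move=> Ow; have [M bM] := back_bounded v Ow.
exists (`|Phi 1%N w (back v w 0)| + M) => -[|m] /=.
  by rewrite lerDl (le_trans _ (bM 0%N)).
by rewrite (le_trans (bM _)) // lerDr.
Qed.

(** The stable part of [v] keeps a bounded forward orbit and its unstable part
    a bounded backward orbit, so the cocycle intertwines the projections. *)
Lemma green_cocycle1 w v : Ot w ->
  green (Phi 1%N w v) (theta w) 0 = Phi 1%N w (green v w 0).
Proof.
move=> Ow; have Otw := invariant_mpt invariant_Ot Ow.
have -> : Phi 1%N w v = 1 *: Phi 1%N w (green v w 0) + Phi 1%N w (back v w 0).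
  by rewrite scale1r -linearD /= addrC subrK.
rewrite green_lin // scale1r (green_of_bounded_forward Otw); last first.
  have [M gM] := green_bounded v Ow; exists M => n.
  by rewrite -cocycleSr -green_posz.
have [-> _] := green_of_bounded_backward Otw (pushed_bounded v Ow)
  (pushed_backward_orbit v Ow).
by rewrite addr0.
Qed.

Lemma green_cocycle n w v : Ot w ->
  green (Phi n w v) (iter n theta w) 0 = Phi n w (green v w 0).
Proof.
move=> Ow; elim: n => [|n IH]; first by rewrite !cocycle0.
rewrite !(cocycleS n) /= green_cocycle1 ?IH //; exact: invariant_iter.
Qed.

Lemma back_cocycle1 w v m : Ot w ->
  back (Phi 1%N w v) (theta w) m.+1 = back v w m.
Proof.
move=> Ow; have Otw := invariant_mpt invariant_Ot Ow.
apply: (back_unique (y := pushed w v)) => //.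
- exact: pushed_bounded.
- exact: pushed_backward_orbit.
- by rewrite green_cocycle1 // -linearB.
Qed.

(** A vector that dies in finite time has a bounded forward orbit, hence is
    stable. *)
Lemma cocycle_injective_unstable n w u : Ot w -> green u w 0 = 0 ->
  Phi n w u = 0 -> u = 0.
Proof.
move=> Ow gu Pu; rewrite -gu; apply/esym/green_of_bounded_forward => //.
exists (\sum_(k < n) `|Phi k w u|) => k.
have [kn|nk] := ltnP k n.
  by rewrite (bigD1 (Ordinal kn)) //= lerDl sumr_ge0.
by rewrite -(subnKC nk) cocycleD Pu linear0 normr0 sumr_ge0.
Qed.

End admissible_dynamics.

(** * Exponential decay along the splitting *)

Section exponential_decay.
Context d {T : measurableType d} {R : realType} {P : probability T R}.
Context (theta : invertible_mpt P) {X : completeNormedModType R}.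
Context (Phi : nat -> T -> bounded_op X).
Hypothesis cocycle_Phi : measurable_cocycle theta Phi.

Local Notation inv := (mpt_inv theta).

Context (zeta : T -> R).
Hypothesis zeta0 : forall w, 0 < zeta w.
Context (Ot : set T) (c : R) (green : X -> T -> int -> X).
Hypothesis invariant_Ot : invariant_set theta Ot.
Hypothesis c0 : 0 < c.
Hypothesis bound_Ot : forall w, Ot w -> admissible_bound theta Phi zeta c w.
Hypothesis green_bounded : forall v w, Ot w -> bounded_seq (green v w).
Hypothesis green_solution : forall v w, Ot w ->
  solution_at theta Phi w (impulse v) (green v w).

Local Notation back := (back green).

Let stopped_sum (s : nat -> R) (n i : nat) : R := \sum_(k < minn i n) s k.

Let stopped_sumS s n i :
  stopped_sum s n i.+1 = stopped_sum s n i + (if (i < n)%N then s i else 0).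
Proof.
rewrite /stopped_sum; case: ifPn => hi; last rewrite -leqNgt in hi.
  by rewrite (minn_idPl hi) (minn_idPl (ltnW hi)) big_ord_recr.
by rewrite (minn_idPr hi) (minn_idPr (leqW hi)) addr0.
Qed.

Let bounded_stopped (s : nat -> R) n (phi : nat -> nat) (x : nat -> X) :
  bounded_seq x -> bounded_seq (fun i => stopped_sum s n (phi i) *: x i).
Proof.
move=> [M xM]; exists (\sum_(k < n) `|s k| * M) => i.
have M0 : 0 <= M by exact: le_trans (xM 0%N).
rewrite normrZ -mulr_suml; apply: ler_pM => //.
rewrite (le_trans (ler_norm_sum _ _ _)) //.
rewrite -(big_mkord xpredT (fun k => `|s k|)).
rewrite -(big_mkord xpredT (fun k => `|s k|)).
rewrite [leRHS](big_cat_nat (n := minn (phi i) n)) //=; last exact: geq_minr.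
by rewrite lerDl sumr_ge0.
Qed.

Let normalized_le1 (z : R) (x : X) : 0 < z ->
  z * `|(z * `|x|)^-1 *: x| <= 1.
Proof.
move=> z0; have [->|x0] := eqVneq x 0; first by rewrite scaler0 normr0 mulr0.
rewrite normrZ ger0_norm; last by rewrite invr_ge0 mulr_ge0 // ltW.
by rewrite mulrCA mulVf // gt_eqF // mulr_gt0 // normr_gt0.
Qed.

(** Test the admissibility bound on the bounded solution
    [(\sum_(k <= j) s k) *: x j], driven by [s j *: x j] for [j < n], where [x]
    is the orbit and [s] normalizes the forcing term to weighted norm one. *)
Lemma green_summed w v n : Ot w ->
  `|green v w n%:Z| *
    \sum_(k < n) (zeta (iter k theta w) * `|green v w k%:Z|)^-1 <= c.
Proof.
move=> Ow; pose x k := green v w k%:Z.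
pose s k := (zeta (iter k theta w) * `|x k|)^-1.
pose e k := if (k < n)%N then s k else 0.
have s0 k : 0 <= s k by rewrite invr_ge0 mulr_ge0 // ltW.
have := bound_Ot Ow (f := glue (fun k => e k *: x k) (fun=> 0))
  (x := glue (fun k => stopped_sum s n k.+1 *: x k) (fun=> 0)) (F := 1).
move=> /(_ _ _ _ n%:Z) /=; rewrite mulr1 /stopped_sum (minn_idPr (leqnSn n)).
rewrite normrZ ger0_norm ?sumr_ge0 // mulrC; apply.
- case=> k /=; last by rewrite normr0 mulr0.
  rewrite /e; case: ifP => _; last by rewrite scale0r normr0 mulr0.
  exact: normalized_le1.
- apply: bounded_glue; last by exists 0 => k; rewrite normr0.
  apply: (bounded_stopped s n succn).
  by have [M gM] := green_bounded v Ow; exists M => k; exact: gM.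
- apply: solution_glue => [k||m] /=.
  + have -> : x k.+1 = Phi 1%N (iter k theta w) (x k).
      rewrite /x (green_posz cocycle_Phi green_solution v k.+1 Ow).
      by rewrite (green_posz cocycle_Phi green_solution v k Ow) -cocycleS.
    rewrite -/(stopped_sum s n k.+1) -/(stopped_sum s n k.+2) stopped_sumS.
    by rewrite linearZ /= scalerDl.
  + rewrite linear0 add0r -/(stopped_sum s n 1) stopped_sumS.
    by rewrite /stopped_sum min0n big_ord0 add0r.
  + by rewrite linear0 add0r.
Qed.

(** In backward time the test solution is [(\sum_(k < i) s k) *: x i] at time
    [- i], which vanishes from time 0 on; it is driven by [- s i *: x i]. *)
Lemma back_summed w v n : Ot w ->
  `|back v w n| *
    \sum_(k < n) (zeta (iter k inv w) * `|back v w k|)^-1 <= c.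
Proof.
move=> Ow; pose x k := back v w k.
pose s k := (zeta (iter k inv w) * `|x k|)^-1.
pose e k := if (k < n)%N then s k else 0.
have s0 k : 0 <= s k by rewrite invr_ge0 mulr_ge0 // ltW.
case: n @e => [|n] e; first by rewrite big_ord0 mulr0 ltW.
have := bound_Ot Ow
  (f := glue (fun k => if k == 0%N then - (e 0%N *: x 0%N) else 0)
             (fun k => - (e k *: x k)))
  (x := glue (fun=> 0) (fun k => stopped_sum s n.+1 k *: x k)) (F := 1).
move=> /(_ _ _ _ (Negz n)) /=; rewrite mulr1 /stopped_sum minnn.
rewrite normrZ ger0_norm ?sumr_ge0 // mulrC; apply.
- have le1 k : zeta (iter k inv w) * `|- (e k *: x k)| <= 1.
    rewrite /e normrN; case: ifP => _; first exact: normalized_le1.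
    by rewrite scale0r normr0 mulr0.
  case=> [[|k]|k]; [exact: (le1 0%N)|by rewrite /= normr0 mulr0|
    exact: (le1 k.+1)].
- apply: bounded_glue; first by exists 0 => k; rewrite normr0.
  apply: (bounded_stopped s n.+1 id).
  exact: (back_bounded green_bounded).
- have xb m : Phi 1%N (iter m.+1 inv w) (x m.+1) = x m.
    exact: (back_backward_orbit green_solution).
  apply: solution_glue => [k||m] /=; first by rewrite linear0 add0r.
  + rewrite linearZ /= (xb 0%N) -/(stopped_sum s n.+1 1) stopped_sumS.
    by rewrite /stopped_sum min0n big_ord0 add0r subrr.
  + rewrite linearZ /= (xb m.+1) -/(stopped_sum s n.+1 m.+2) stopped_sumS.
    by rewrite scalerDl -/(e m.+1) addrK.
Qed.

(** [decay_of_summed_bound] applies on both half orbits; that a vanishing term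
    stays zero is clear forwards, and is injectivity on the unstable part
    backwards. *)
Lemma green_back_decay (B : set T) w : Ot w ->
  (forall v, ~ B v -> zeta v <= c) ->
  half_avoids (R := R) theta B w -> half_avoids (R := R) inv B w ->
  let al := ln (1 + (c * c)^-1) / 2 in
  exists C : R, forall v (n : nat),
    `|green v w n%:Z| <= C * `|v| * expR (- al * n%:R) /\
    `|back v w n| <= C * `|v| * expR (- al * n%:R).
Proof.
move=> Ow Bz [m1 H1] [m2 H2] al.
have al0 : 0 <= al.
  by rewrite divr_ge0 // ln_ge0 // lerDl invr_ge0 mulr_ge0 // ltW.
have bz tau k : \1_B (iter k tau w) = 1 :> R \/
    \1_B (iter k tau w) = 0 :> R /\ zeta (iter k tau w) <= c.
  rewrite indicE; have [hB|hB] := pselect (B (iter k tau w)).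
    by left; rewrite mem_set.
  by right; rewrite memNset //; split => //; exact: Bz.
pose C m := 1 + c * zeta w * expR (2 * al * (m + 1)).
have C0 m : 0 <= C m.
  by rewrite addr_ge0 // !mulr_ge0 ?expR_ge0 // ltW.
pose c1 := C m1%:R * (c * zeta w); pose c2 := C m2%:R * (1 + c * zeta w).
have c10 : 0 <= c1 by rewrite !mulr_ge0 // ltW.
have c20 : 0 <= c2 by rewrite mulr_ge0 // addr_ge0 // mulr_ge0 // ltW.
exists (c1 + c2) => v n; split.
  have zeroS k : `|green v w k%:Z| = 0 -> `|green v w k.+1%:Z| = 0.
    move=> /eqP; rewrite normr_eq0 => /eqP gk.
    rewrite (green_posz cocycle_Phi green_solution v k.+1 Ow).
    rewrite (cocycleS cocycle_Phi).
    by rewrite -(green_posz cocycle_Phi green_solution v k Ow) gk linear0 normr0.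
  apply: (le_trans (@decay_of_summed_bound _ (fun k => `|green v w k%:Z|)
    (fun k => zeta (iter k theta w)) (fun k => \1_B (iter k theta w))
    c m1%:R c0 _ _ zeroS (bz theta) H1 _ n)) => // [k|].
    exact: green_summed.
  rewrite ler_wpM2r ?expR_ge0 //=.
  apply: (@le_trans _ _ (c1 * `|v|)); last first.
    by rewrite ler_wpM2r // lerDl.
  rewrite /c1 -[leRHS]mulrA; apply: ler_wpM2l; first exact: C0.
  rewrite -mulrA.
  exact: (green_le zeta0 bound_Ot green_bounded green_solution).
have zeroS k : `|back v w k| = 0 -> `|back v w k.+1| = 0.
  move=> /eqP; rewrite normr_eq0 => /eqP bk.
  rewrite (cocycle_injective_unstable cocycle_Phi bound_Ot green_bounded
    green_solution (n := 1) (w := iter k.+1 inv w) (u := back v w k.+1)) ?normr0 //.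
  - exact: invariant_iter_inv.
  - apply: (green_back invariant_Ot bound_Ot green_bounded
      green_solution) => //.
  - by rewrite (back_backward_orbit green_solution).
apply: (le_trans (@decay_of_summed_bound _ (fun k => `|back v w k|)
  (fun k => zeta (iter k inv w)) (fun k => \1_B (iter k inv w))
  c m2%:R c0 _ _ zeroS (bz inv) H2 _ n)) => // [k|].
  exact: back_summed.
rewrite ler_wpM2r ?expR_ge0 //=.
apply: (@le_trans _ _ (c2 * `|v|)); last first.
  by rewrite ler_wpM2r // lerDr.
rewrite /c2 -[leRHS]mulrA; apply: ler_wpM2l; first exact: C0.
rewrite mulrDl mul1r.
rewrite (le_trans (ler_normB _ _)) // lerD2l -mulrA.
exact: (green_le zeta0 bound_Ot green_bounded green_solution).
Qed.

End exponential_decay.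

(** * The tempered constant and the dichotomy *)

Section dichotomy.
Context d {T : measurableType d} {R : realType} {P : probability T R}.
Context (theta : invertible_mpt P) {X : completeNormedModType R}.
Context (Phi : nat -> T -> bounded_op X).
Hypothesis separable_X : separable X.
Hypothesis cocycle_Phi : measurable_cocycle theta Phi.
Hypothesis log_integrable_Phi : log_integrable P Phi.

Local Notation inv := (mpt_inv theta).

Context (zeta : T -> R).
Hypothesis zeta0 : forall w, 0 < zeta w.
Context (Ot : set T) (c : R) (green : X -> T -> int -> X).
Hypothesis invariant_Ot : invariant_set theta Ot.
Hypothesis full_Ot : full_measure P Ot.
Hypothesis bound_Ot : forall w, Ot w -> admissible_bound theta Phi zeta c w.
Hypothesis green_bounded : forall v w, Ot w -> bounded_seq (green v w).
Hypothesis green_solution : forall v w, Ot w ->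
  solution_at theta Phi w (impulse v) (green v w).
Hypothesis measurable_green : forall v, measurable_on Ot (green v).
Context (al : R).
Hypothesis al0 : 0 < al.
Hypothesis green_decay : forall w, Ot w -> exists C : R, forall v (n : nat),
  `|green v w n%:Z| <= C * `|v| * expR (- al * n%:R) /\
  `|back green v w n| <= C * `|v| * expR (- al * n%:R).

Local Notation back := (back green).

Let greenP w v n (Ow : Ot w) := green_posz cocycle_Phi green_solution v n Ow.

Let green_linear w n (Ow : Ot w) a v v' :=
  green_lin bound_Ot green_bounded green_solution a v v' n Ow.

Let green0 w n : Ot w -> green 0 w n = 0.
Proof.
move=> Ow; have := green_linear n Ow (-1) 0 0.
by rewrite scaler0 addr0 scaleN1r addNr.
Qed.

Let greenZ w n : Ot w -> forall a v, green (a *: v) w n = a *: green v w n.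
Proof.
move=> Ow a v; have := green_linear n Ow a v 0.
by rewrite addr0 green0 // addr0.
Qed.

Lemma back_linear w n : Ot w -> forall a v v',
  back (a *: v + v') w n = a *: back v w n + back v' w n.
Proof.
move=> Ow a v v'; case: n => [|n] /=; rewrite green_linear //.
  by rewrite scalerBr opprD addrACA.
by rewrite opprD scalerN.
Qed.

Let backZ w n : Ot w -> forall a v, back (a *: v) w n = a *: back v w n.
Proof.
move=> Ow a v; have := back_linear n Ow a v 0; rewrite addr0 => ->.
by case: n => [|n] /=; rewrite green0 // ?subrr ?oppr0 addr0.
Qed.

Let green_continuous w n : Ot w -> continuous (fun v => green v w n%:Z).
Proof.
move=> Ow; have [C CP] := green_decay Ow.
apply: (@continuous_of_linear_bound _ _ _ (C * expR (- al * n%:R))).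
  by move=> a x y; exact: green_linear.
by move=> v; rewrite mulrAC; have [] := CP v n.
Qed.

Let back_continuous w n : Ot w -> continuous (fun v => back v w n).
Proof.
move=> Ow; have [C CP] := green_decay Ow.
apply: (@continuous_of_linear_bound _ _ _ (C * expR (- al * n%:R))).
  by move=> a x y; exact: back_linear.
by move=> v; rewrite mulrAC; have [] := CP v n.
Qed.

Lemma measurable_back v n :
  measurable_fun Ot (fun w => back v w n : borel X).
Proof.
case: n => [|n].
  apply: (@measurable_borel_comp _ _ X X Ot (fun w => green v w 0)
    (fun x => v - x)) => [x|]; last exact: measurable_green.
  by apply: cvgB; [exact: cvg_cst|exact: cvg_id].
apply: (@measurable_borel_comp _ _ X X Ot (fun w => green v w (Negz n))
  (fun x => - x)) => [x|]; last exact: measurable_green.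
exact: opp_continuous.
Qed.

(** Written as a countable supremum of operator norms to make it measurable; it
    is the least constant in both exponential bounds ([dichotomy_bound_leP]). *)
Definition dichotomy_bound (w : T) : \bar R :=
  ereal_sup (range (fun n : nat => (expR (al * n%:R))%:E *
    maxe (opnorm (fun v => green v w n%:Z)) (opnorm (fun v => back v w n))))%E.

Lemma measurable_dichotomy_bound : measurable_fun Ot dichotomy_bound.
Proof.
apply: measurable_ereal_sup_range => n.
apply: emeasurable_funM; first exact: measurable_cst.
apply: measurable_maxe; apply: measurable_opnorm => //.
- by move=> v; exact: measurable_green.
- by move=> w Ow a x; exact: greenZ.
- by move=> w Ow; exact: green_continuous.
- by move=> v; exact: measurable_back.
- by move=> w Ow a x; exact: backZ.
- by move=> w Ow; exact: back_continuous.
Qed.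

Lemma dichotomy_bound_leP w (r : R) : Ot w -> 0 <= r ->
  (dichotomy_bound w <= r%:E)%E <-> forall v n,
    `|green v w n%:Z| <= r * `|v| * expR (- al * n%:R) /\
    `|back v w n| <= r * `|v| * expR (- al * n%:R).
Proof.
move=> Ow r0.
have re0 n : 0 <= r * expR (- al * n%:R) by rewrite mulr_ge0 ?expR_ge0.
have nP (n : nat) : ((expR (al * n%:R))%:E *
    maxe (opnorm (fun v => green v w n%:Z)) (opnorm (fun v => back v w n))
      <= r%:E)%E <->
    (forall v, `|green v w n%:Z| <= r * `|v| * expR (- al * n%:R)) /\
    (forall v, `|back v w n| <= r * `|v| * expR (- al * n%:R)).
  rewrite -lee_pdivlMl ?expR_gt0 // -EFinM -expRN mulrC -mulNr ge_max.
  split.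
    move=> /andP[/(opnorm_leP (greenZ _ Ow) (re0 n)) gP].
    move=> /(opnorm_leP (backZ _ Ow) (re0 n)) bP.
    by split=> v; rewrite mulrAC.
  move=> [gP bP]; apply/andP; split.
    by apply/(opnorm_leP (greenZ _ Ow) (re0 n)) => v; rewrite mulrAC.
  by apply/(opnorm_leP (backZ _ Ow) (re0 n)) => v; rewrite mulrAC.
split => [H v n|H].
  have /nP[gP bP] := le_trans (ereal_sup_ubound (ex_intro2 _ _ n I erefl)) H.
  by split.
apply: ge_ereal_sup => _ [n _ <-]; apply/nP.
by split => v; have [] := H v n.
Qed.

Lemma dichotomy_bound_ge0 w : (0 <= dichotomy_bound w)%E.
Proof.
apply: (@le_trans _ _ ((expR (al * 0%:R))%:E * maxe (opnorm (fun v =>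
  green v w 0%:Z)) (opnorm (fun v => back v w 0%N))))%E.
  by rewrite mule_ge0 ?lee_fin ?expR_ge0 // le_max opnorm_ge0.
by apply: ereal_sup_ubound; exists 0%N.
Qed.

Lemma dichotomy_bound_fin w : Ot w -> dichotomy_bound w \is a fin_num.
Proof.
move=> Ow; rewrite ge0_fin_numE ?dichotomy_bound_ge0 //.
have [C CP] := green_decay Ow.
apply: (@le_lt_trans _ _ (`|C|)%:E); last exact: ltry.
apply/dichotomy_bound_leP => // v n; have [gP bP] := CP v n.
have le_abs : C * `|v| * expR (- al * n%:R) <= `|C| * `|v| * expR (- al * n%:R).
  by rewrite ler_wpM2r ?expR_ge0 // ler_wpM2r // ler_norm.
by split; [exact: le_trans gP le_abs|exact: le_trans bP le_abs].
Qed.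

Lemma dichotomy_boundP w v n : Ot w ->
  `|green v w n%:Z| <= fine (dichotomy_bound w) * `|v| * expR (- al * n%:R) /\
  `|back v w n| <= fine (dichotomy_bound w) * `|v| * expR (- al * n%:R).
Proof.
move=> Ow; move: v n; apply/dichotomy_bound_leP => //.
  exact/fine_ge0/dichotomy_bound_ge0.
by rewrite fineK ?dichotomy_bound_fin.
Qed.

Let a w := fine (opnorm (generator Phi w)).

Let a_ge0 w : 0 <= a w.
Proof. exact/fine_ge0/opnorm_ge0. Qed.

(** Since [back v w n = back (Phi 1 w v) (theta w) n.+1], the unstable bounds at
    [w] follow from those at [theta w] and the norm of the generator; the
    stable bound at time zero is then obtained from [v - back v w 0]. *)
Lemma dichotomy_bound_step w : Ot w -> fine (dichotomy_bound w) <=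
  1 + expR al * a w * fine (dichotomy_bound (theta w)).
Proof.
move=> Ow; have Otw := invariant_mpt invariant_Ot Ow.
set k := fine (dichotomy_bound (theta w)).
have k0 : 0 <= k by exact/fine_ge0/dichotomy_bound_ge0.
have ak0 : 0 <= a w * k by rewrite mulr_ge0.
have e1 : 1 <= expR al by rewrite -expR0 ler_expR ltW.
rewrite -lee_fin fineK ?dichotomy_bound_fin //.
have r0 : 0 <= 1 + expR al * a w * k.
  by rewrite addr_ge0 // !mulr_ge0 ?expR_ge0.
have Av v : `|Phi 1%N w v| <= a w * `|v| by exact: bounded_opE.
have back_le v n : `|back v w n| <=
    (a w * k) * `|v| * expR (- al * n%:R) .
  have [_] := dichotomy_boundP (Phi 1%N w v) n.+1 Otw.
  rewrite (back_cocycle1 cocycle_Phi invariant_Ot bound_Ot green_bounded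
    green_solution) // => /le_trans; apply.
  rewrite -/k -natr1 mulrDr mulr1 expRD mulrA -[leRHS]mulr1.
  apply: ler_pM => //; rewrite ?mulr_ge0 ?expR_ge0 //.
    rewrite ler_wpM2r ?expR_ge0 // (mulrC (a w)) -mulrA ler_wpM2l //.
  by rewrite -expR0 ler_expR oppr_le0 ltW.
have le_r (v : X) n : (a w * k) * `|v| * expR (- al * n%:R) <=
    (1 + expR al * a w * k) * `|v| * expR (- al * n%:R).
  rewrite ler_wpM2r ?expR_ge0 // ler_wpM2r // -mulrA.
  have : a w * k <= expR al * (a w * k) by rewrite ler_peMl.
  by move: (a w * k) (expR al * _) => *; lra.
apply/dichotomy_bound_leP => // v n; split; last first.
  exact: le_trans (back_le v n) (le_r v n).
case: n => [|n].
  have -> : green v w 0 = v - back v w 0 by rewrite /= opprB addrC subrK.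
  rewrite (le_trans (ler_normB _ _)) //; have := back_le v 0%N.
  rewrite mulr0 expR0 !mulr1 => le_b; rewrite mulrDl mul1r lerD2l.
  apply: (le_trans le_b); rewrite ler_wpM2r // -mulrA ler_peMl //.
have [gP _] := dichotomy_boundP (Phi 1%N w v) n Otw.
have -> : green v w n.+1%:Z = green (Phi 1%N w v) (theta w) n%:Z.
  rewrite (greenP v n.+1 Ow) (greenP _ n Otw) (cocycleSr cocycle_Phi).
  by rewrite (green_cocycle1 cocycle_Phi invariant_Ot bound_Ot green_bounded
    green_solution).
apply: (le_trans gP); rewrite -/k.
apply: (@le_trans _ _ (k * (a w * `|v|) * expR (- al * n%:R))).
  by rewrite ler_wpM2r ?expR_ge0 // ler_wpM2l.
have -> : expR (- al * n%:R) = expR al * expR (- al * n.+1%:R).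
  by rewrite -expRD; congr expR; rewrite -(natr1 n); ring.
have -> : k * (a w * `|v|) * (expR al * expR (- al * n.+1%:R)) =
  (expR al * a w * k) * (`|v| * expR (- al * n.+1%:R)) by ring.
by rewrite -[leRHS]mulrA ler_wpM2r ?mulr_ge0 ?expR_ge0 // lerDr.
Qed.

Definition dichotomy_const (w : T) : R :=
  1 + ((fun v => fine (dichotomy_bound v)) \_ Ot) w.

Lemma dichotomy_constE w : Ot w ->
  dichotomy_const w = 1 + fine (dichotomy_bound w).
Proof. by move=> Ow; rewrite /dichotomy_const patchE mem_set. Qed.

Lemma dichotomy_const_ge1 w : 1 <= dichotomy_const w.
Proof.
rewrite /dichotomy_const patchE; case: ifP => _; last by rewrite addr0.
by rewrite lerDl; exact/fine_ge0/dichotomy_bound_ge0.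
Qed.

Lemma measurable_dichotomy_const : measurable_fun [set: T] dichotomy_const.
Proof.
apply: measurable_funD => //; have [mOt _] := full_Ot.
apply/(measurable_restrictT _ mOt).
by apply: measurableT_comp; [exact: fine_measurable|
  exact: measurable_dichotomy_bound].
Qed.

Let h w := ln (2 + expR al * a w).

Let h_arg_ge1 w : 1 <= 2 + expR al * a w.
Proof.
have : 0 <= expR al * a w by rewrite mulr_ge0 ?expR_ge0.
by move: (expR al * a w) => *; lra.
Qed.

Let measurable_a : measurable_fun [set: T] a.
Proof.
apply: measurableT_comp; first exact: fine_measurable.
apply: measurable_opnorm => //.
- by case: cocycle_Phi => _ _ /(_ 1%N).
- by move=> w _ r x; exact: linearZ.
- by move=> w _; exact: bounded_op_continuous.
Qed.

Let integrable_h : (\int[P]_w (h w)%:E < +oo)%E.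
Proof.
have L_E w : maxe 0%E (lne (opnorm (generator Phi w))) =
    (Num.max 0 (ln (a w)))%:E.
  rewrite -(fineK (opnorm_fin_num _)) -/(a w) /=; case: ifP => [a_le0|_].
    by rewrite ln0 // maxxx; apply/max_idPl; rewrite leNye.
  by rewrite EFin_max.
have le_h w : h w <= (ln 3 + al) + Num.max 0 (ln (a w)).
  have m0 : 0 < Num.max 1 (a w) by rewrite lt_max ltr01.
  have -> : Num.max 0 (ln (a w)) = ln (Num.max 1 (a w)).
    have [a1|a1] := leP (a w) 1.
      rewrite ln1; apply/max_idPl.
      have [a_le0|a_gt0] := leP (a w) 0; first by rewrite ln0.
      exact: ln_le0.
    by apply/max_idPr; rewrite ln_ge0 // ltW.
  rewrite -{1}(expRK al) -lnM ?posrE ?expR_gt0 // -lnM ?posrE ?mulr_gt0 ?expR_gt0 //.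
  rewrite ler_ln ?posrE ?mulr_gt0 ?expR_gt0 //; last first.
    exact: lt_le_trans (h_arg_ge1 w).
  have e1 : 1 <= expR al by rewrite -expR0 ler_expR ltW.
  have m1 : 1 <= expR al * Num.max 1 (a w).
    by rewrite -[leLHS]mulr1 ler_pM // le_max lexx.
  have ma : expR al * a w <= expR al * Num.max 1 (a w).
    by rewrite ler_wpM2l ?expR_ge0 // le_max lexx orbT.
  rewrite -mulrA; move: m1 ma; move: (expR al * Num.max 1 (a w)) (expR al * a w).
  by move=> *; lra.
have mln : measurable_fun [set: T] (fun w => Num.max 0 (ln (a w))).
  apply: (measurable_maxr (f := fun=> 0)) => //.
  exact: measurableT_comp measurable_a.
have c0 : 0 <= ln 3 + al :> R by rewrite addr_ge0 ?ln_ge0 ?ltW // ltr1n.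
have max0 w : 0 <= Num.max 0 (ln (a w)) by rewrite le_max lexx.
apply: (@le_lt_trans _ _
    (\int[P]_w ((ln 3 + al)%:E + (Num.max 0 (ln (a w)))%:E))%E).
  apply: ge0_le_integral => //.
  - by move=> w _; rewrite lee_fin ln_ge0.
  - apply/measurable_EFinP; apply: measurableT_comp => //.
    by apply: measurable_funD => //; apply: measurable_funM.
  - by apply: emeasurable_funD => //; exact/measurable_EFinP.
  - by move=> w _; rewrite -EFinD lee_fin.
rewrite ge0_integralD //; last 2 first.
- by move=> w _; rewrite lee_fin.
- exact/measurable_EFinP.
rewrite integral_cst // lte_add_pinfty //.
  by rewrite lte_mul_pinfty ?lee_fin // (le_lt_trans (probability_le1 _ _)) ?ltry.
move: log_integrable_Phi; rewrite /log_integrable.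
by rewrite (eq_integral _ _ (fun w _ => L_E w)).
Qed.

(** By [dichotomy_bound_step] the quotient [K / K \o theta] is at most
    [2 + expR al * a], whose logarithm is integrable with that of the generator
    norm. *)
Lemma tempered_dichotomy_const : tempered theta dichotomy_const.
Proof.
apply: (@tempered_of_step _ _ _ _ _ _ h) => //.
- exact: measurable_dichotomy_const.
- exact: dichotomy_const_ge1.
- apply: measurableT_comp => //.
  by apply: measurable_funD => //; apply: measurable_funM.
- by move=> w; rewrite ln_ge0.
move=> w; have K1 := dichotomy_const_ge1.
have [Ow|nOw] := pselect (Ot w); last first.
  rewrite {1}/dichotomy_const patchE memNset // addr0 ln1.
  by rewrite addr_ge0 ?ln_ge0.
have Otw := invariant_mpt invariant_Ot Ow.
have K0 v : 0 < dichotomy_const v by exact: lt_le_trans (K1 v).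
have H0 : 0 < 2 + expR al * a w by exact: lt_le_trans (h_arg_ge1 w).
rewrite -lnM ?posrE // ler_ln ?posrE ?mulr_gt0 //.
rewrite !dichotomy_constE //; have := dichotomy_bound_step Ow.
have : 0 <= fine (dichotomy_bound (theta w)).
  exact/fine_ge0/dichotomy_bound_ge0.
have : 0 <= expR al * a w by rewrite mulr_ge0 ?expR_ge0.
move: (expR al * a w) (fine _) (fine _) => x y z x0 z0 le_y.
rewrite mulrDl mul1r; nra.
Qed.

Section projections.
Context (Ps : T -> bounded_op X).
Hypothesis PsE : forall w, Ot w -> forall v, Ps w v = green v w 0.

Local Notation Pu := (complementary Ps).

Let range_Pu w v : Ot w -> range (Pu w) v <-> green v w 0 = 0.
Proof.
move=> Ow; split => [[x _ <-]|gv].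
  rewrite /complementary PsE //.
  by have := green_unstable invariant_Ot bound_Ot green_bounded green_solution x Ow.
by exists v; rewrite // /complementary PsE // gv subr0.
Qed.

Let cocycle_inj w n : Ot w -> {in range (Pu w) &, injective (Phi n w)}.
Proof.
move=> Ow x y /set_mem/(range_Pu _ Ow) gx /set_mem/(range_Pu _ Ow) gy Pxy.
apply/eqP; rewrite -subr_eq0; apply/eqP.
apply: (cocycle_injective_unstable cocycle_Phi bound_Ot green_bounded
  green_solution (n := n) Ow).
  rewrite -[x]scale1r addrC -scaleN1r green_linear // greenZ //.
  by rewrite gx gy !scaler0 addr0.
by rewrite linearB /= Pxy subrr.
Qed.

Let back_orbit w v m (Ow : Ot w) : Phi m (iter m inv w) (back v w m) = Pu w v.
Proof.
have := backward_orbitD cocycle_Phi 0 m (back_backward_orbit green_solution v Ow).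
by rewrite add0n /= => ->; rewrite /complementary PsE.
Qed.

Let range_back w v m (Ow : Ot w) : range (Pu (iter m inv w)) (back v w m).
Proof.
apply/range_Pu; first exact: invariant_iter_inv.
exact: (green_back invariant_Ot bound_Ot green_bounded green_solution).
Qed.

Lemma cocycle_neg_back m w v : Ot w ->
  cocycle_neg theta Phi Pu m w (Pu w v) = back v w m.
Proof.
move=> Ow; rewrite /cocycle_neg mpt_iterN -(back_orbit v m Ow).
rewrite pinvKV ?inE //; last exact: range_back.
by apply: cocycle_inj; exact: invariant_iter_inv.
Qed.

Lemma dichotomy_of_green : tempered_exponential_dichotomy theta Phi.
Proof.
exists Ot, Ps => /=; split.
- split=> // v; apply: (eq_measurable_fun (fun w => green v w 0 : borel X)).
    by move=> w; rewrite inE => Ow; rewrite PsE.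
  exact: measurable_green.
- move=> w Ow x; rewrite !PsE //.
  exact: (green_idem cocycle_Phi bound_Ot green_bounded green_solution).
- move=> w Ow n x; rewrite !PsE //; last exact: invariant_iter.
  exact: (green_cocycle cocycle_Phi invariant_Ot bound_Ot green_bounded
    green_solution).
- split=> [w Ow n|m v]; last first.
    apply: (eq_measurable_fun (fun w => back v w m : borel X)).
      by move=> w; rewrite inE => Ow; rewrite cocycle_neg_back.
    exact: measurable_back.
  have Onw := invariant_iter (theta := theta) invariant_Ot n Ow.
  split; last 1 first.
  + move=> _ [v _ <-]; exists (back v (iter n theta w) n).
      by have := range_back v n Onw; rewrite iter_mptK.
    by have := back_orbit v n Onw; rewrite iter_mptK.
  + move=> v /(range_Pu _ Ow) gv; apply/(range_Pu _ Onw).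
    rewrite (green_cocycle cocycle_Phi invariant_Ot bound_Ot green_bounded
      green_solution) //.
    by rewrite gv linear0.
  + exact: cocycle_inj.
exists (fun=> al), dichotomy_const; split => //.
- by split; [exact: measurable_dichotomy_const|
    move=> w; exact: lt_le_trans (dichotomy_const_ge1 w)].
- exact: tempered_dichotomy_const.
move=> w Ow n; rewrite mulrN -mulNr.
have K0 : 0 <= dichotomy_const w * expR (- al * n%:R).
  by rewrite mulr_ge0 ?expR_ge0 // (le_trans _ (dichotomy_const_ge1 w)).
have le_K (v : X) : fine (dichotomy_bound w) * `|v| * expR (- al * n%:R) <=
    dichotomy_const w * expR (- al * n%:R) * `|v|.
  rewrite [leRHS]mulrAC ler_wpM2r ?expR_ge0 // ler_wpM2r //.
  by rewrite dichotomy_constE // lerDr.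
split.
  apply/opnorm_leP => // [r x|v]; first by rewrite !linearZ.
  rewrite PsE // -greenP //; have [gP _] := dichotomy_boundP v n Ow.
  exact: le_trans gP (le_K v).
apply/opnorm_leP => // [r x|v].
  by rewrite !cocycle_neg_back // backZ.
rewrite cocycle_neg_back //; have [_ bP] := dichotomy_boundP v n Ow.
exact: le_trans bP (le_K v).
Qed.

End projections.

Lemma exists_projections :
  exists Ps : T -> bounded_op X, forall w, Ot w -> forall v, Ps w v = green v w 0.
Proof.
suff /choice[Ps PsE] : forall w, exists B : bounded_op X,
    Ot w -> forall v, B v = green v w 0 by exists Ps.
move=> w; have [Ow|nOw] := pselect (Ot w); last by exists (Phi 0%N w).
have lin : linear (fun v => green v w 0).
  by move=> r x y; exact: green_linear.
pose L := GRing.isLinear.Build _ _ _ _ (fun v => green v w 0) lin.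
pose G : {linear X -> X} := HB.pack (fun v => green v w 0) L.
have cG : continuous G by exact: (@green_continuous w 0%N Ow).
by exists (BoundedOp cG).
Qed.

End dichotomy.

(** * Good points and admissibility bounds *)

Section invariant_sets.
Context d {T : measurableType d} {R : realType} {P : probability T R}.
Context (theta : invertible_mpt P).

Lemma ergodic_mpt_inv : ergodic theta -> forall E, measurable E ->
  mpt_inv theta @^-1` E = E -> P E = 0%E \/ P E = 1%E.
Proof.
move=> erg E mE EE; apply: erg => //.
by rewrite -{1}EE -comp_preimage; apply/seteqP; split => w /=; rewrite mpt_funK.
Qed.

Lemma invariant_set_preimage_inv A :
  mpt_inv theta @^-1` A = A -> invariant_set theta A.
Proof.
move=> AA; apply/seteqP; split=> [_ [w Aw <-]|w Aw].
  by rewrite -AA /= mpt_funK.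
by exists (mpt_inv theta w); rewrite ?mpt_invK //; move: Aw; rewrite -{1}AA.
Qed.

Lemma invariant_set_preimage A : theta @^-1` A = A -> invariant_set theta A.
Proof.
move=> AA; apply: invariant_set_preimage_inv; rewrite -{1}AA -comp_preimage.
by apply/seteqP; split => w /=; rewrite mpt_invK.
Qed.

Lemma invariant_setI A B : invariant_set theta A -> invariant_set theta B ->
  invariant_set theta (A `&` B).
Proof.
move=> iA iB; apply/seteqP; split=> [_ [w [Aw Bw] <-]|w [Aw Bw]].
  by split; apply: invariant_mpt.
exists (mpt_inv theta w); last exact: mpt_invK.
by split; apply: invariant_mpt_inv.
Qed.

End invariant_sets.

Section good_points.
Context d {T : measurableType d} {R : realType} (P : probability T R).

Lemma exists_rare_above (g : T -> R) : measurable_fun [set: T] g ->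
  exists D : nat, (P [set w | (D%:R < g w)%R] < (2^-1)%:E)%E.
Proof.
move=> mg; have [||||D _ le_D] := @integral_restrict_above_small _ _ _ P g
  (fun=> 1) mg _ _ _ 4^-1.
- exact: measurable_cst.
- by move=> _; exact: ler01.
- by rewrite integral_cst // mul1e (le_lt_trans (probability_le1 _ _)) ?ltry.
- by rewrite invr_gt0.
exists D; have := le_D D (leqnn D).
rewrite (eq_integral (fun w => (\1_[set v | D%:R < g v] w)%:E)); last first.
  by move=> w _; rewrite /restrict_above mul1r.
rewrite integral_indic //; last exact: measurable_above.
rewrite setIT => /le_lt_trans; apply; rewrite lte_fin.
by rewrite ltf_pV2 ?posrE // ltr_nat.
Qed.

(** An orbit that never leaves [A] violates [n <= n / 2 + m] at [n = 2 m + 1]. *)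
Lemma half_avoids_visit (tau : T -> T) (A : set T) w :
  half_avoids (R := R) tau A w -> exists n, ~ A (iter n tau w).
Proof.
move=> [m H]; apply: contrapT => none.
have := H (m.*2.+1)%N; rewrite /orbit_sum (eq_bigr (fun=> 1)); last first.
  move=> i _; rewrite indicE mem_set //=; apply: contrapT => nA.
  by apply: none; exists i.
rewrite sumr_const card_ord -natr1 -muln2 natrM.
by move: (m%:R : R) => x; lra.
Qed.

Lemma full_measureI (A B : set T) : full_measure P A -> full_measure P B ->
  full_measure P (A `&` B).
Proof.
move=> [mA A0] [mB B0]; split; first exact: measurableI.
by rewrite setCI measureU0 //; exact: measurableC.
Qed.

Lemma full_measure1 (A : set T) : measurable A -> P A = 1%E -> full_measure P A.
Proof. by move=> mA PA; split; rewrite ?probability_setC ?PA ?subee. Qed.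

End good_points.

Section norms_and_bounds.
Context d {T : measurableType d} {R : realType} {P : probability T R}.
Context (theta : invertible_mpt P) {X : completeNormedModType R}.
Context (Phi : nat -> T -> bounded_op X).

Lemma weighted_sup_norm_leP (z : int -> R) (u : int -> X) (F : R) :
  (weighted_sup_norm z u <= F%:E)%E <-> forall n, z n * `|u n| <= F.
Proof.
split=> [H n|H].
  by rewrite -lee_fin; apply: le_trans H; apply: ereal_sup_ubound; exists n.
by apply: ge_ereal_sup => _ [n _ <-]; rewrite lee_fin.
Qed.

Lemma ell_infty1P (u : int -> X) : ell_infty1 u <-> bounded_seq u.
Proof.
split=> [H|[M uM]].
  have : sup_norm u \is a fin_num.
    rewrite ge0_fin_numE //; apply: (@le_trans _ _ (1 * `|u 0|)%:E).
      by rewrite lee_fin mul1r.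
    by apply: ereal_sup_ubound; exists 0.
  move=> fin; exists (fine (sup_norm u)) => n; rewrite -[leLHS]mul1r.
  by move: n; apply/(weighted_sup_norm_leP (fun=> 1)); rewrite fineK.
apply: (@le_lt_trans _ _ M%:E); last exact: ltry.
by apply/weighted_sup_norm_leP => n; rewrite mul1r.
Qed.

Lemma admissible_bound_of_norms (zeta : T -> R) (c : R) w : 0 <= c ->
  (forall f x : int -> X,
    weighted_ell_infty (orbit_weight theta zeta w) f -> ell_infty1 x ->
    solution_at theta Phi w f x ->
    (sup_norm x <= c%:E * weighted_sup_norm (orbit_weight theta zeta w) f)%E) ->
  admissible_bound theta Phi zeta c w.
Proof.
move=> c0 H f x F fF bx sol n.
have fF' : (weighted_sup_norm (orbit_weight theta zeta w) f <= F%:E)%E.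
  exact/weighted_sup_norm_leP.
have le_cF : (sup_norm x <= (c * F)%:E)%E.
  apply: (le_trans (H f x _ _ sol)).
  - exact: le_lt_trans fF' (ltry F).
  - exact/ell_infty1P.
  - by rewrite EFinM lee_wpmul2l ?lee_fin.
by rewrite -[leLHS]mul1r; move: n; apply/(weighted_sup_norm_leP (fun=> 1)).
Qed.

Lemma admissible_bound_le (zeta : T -> R) (c c' : R) w :
  (forall v, 0 <= zeta v) -> c <= c' ->
  admissible_bound theta Phi zeta c w -> admissible_bound theta Phi zeta c' w.
Proof.
move=> z0 cc' H f x F fF bx sol n; apply: (le_trans (H f x F fF bx sol n)).
by rewrite ler_wpM2r // (le_trans _ (fF 0)) // mulr_ge0.
Qed.

(** The impulse does not depend on the base point, so it is a measurable forcing
    term and the solution is measurable too. *)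
Lemma exists_green (zeta : T -> R) (Ot : set T) :
  (forall w, 0 < zeta w) ->
  measurably_properly_admissible theta Phi Ot
    (ell_infty_on theta Ot zeta) (ell_infty1_on Ot) ->
  exists green : X -> T -> int -> X, forall v,
    [/\ forall w, Ot w -> bounded_seq (green v w),
        forall w, Ot w -> solution_at theta Phi w (impulse v) (green v w)
      & measurable_on Ot (green v)].
Proof.
move=> z0 adm.
suff /choice[green gP] : forall v, exists g : T -> int -> X,
  [/\ forall w, Ot w -> bounded_seq (g w),
      forall w, Ot w -> solution_at theta Phi w (impulse v) (g w)
    & measurable_on Ot g] by exists green.
move=> v; have [|x [bx sol _ mx]] := adm (fun=> impulse v).
  move=> w Ow; apply: (@le_lt_trans _ _ (zeta w * `|v|)%:E); last exact: ltry.
  apply/weighted_sup_norm_leP => n; rewrite /impulse; case: eqP => [->|_] //.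
  by rewrite normr0 mulr0 mulr_ge0 // ltW.
exists x; split => //.
- by move=> w Ow; apply/ell_infty1P; exact: bx.
- by apply: mx => n; exact: measurable_cst.
Qed.

End norms_and_bounds.

Theorem theorem3 (R : realType)
    (X : completeNormedModType R) (sepX : separable X)
    (Omega : pointedMetricType R) (compactOmega : compact [set: Omega])
    (P : probability (borel Omega) R)
    (theta : invertible_mpt P) (ergodic_theta : ergodic theta)
    (Phi : nat -> borel Omega -> bounded_op X)
    (cocycle_Phi : measurable_cocycle theta Phi)
    (log_integrable_Phi : log_integrable P Phi)
    (quasi_compact_Phi : quasi_compact P Phi)
    (Ot : set (borel Omega))
    (invariant_Ot : invariant_set theta Ot) (full_Ot : full_measure P Ot)
    (zeta eta : borel Omega -> R)
    (rv_zeta : positive_rv zeta) (rv_eta : positive_rv eta)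
    (admissible_Phi : measurably_properly_admissible theta Phi Ot
      (ell_infty_on theta Ot zeta) (ell_infty1_on Ot))
    (bound_Phi : forall w, Ot w -> forall f x : int -> X,
      weighted_ell_infty (orbit_weight theta zeta w) f ->
      ell_infty1 x ->
      solution_at theta Phi w f x ->
      (sup_norm x <=
        (eta w)%:E * weighted_sup_norm (orbit_weight theta zeta w) f)%E) :
  tempered_exponential_dichotomy theta Phi.
Proof.
have [mz z0] := rv_zeta; have [me e0] := rv_eta.
have [D rareD] := exists_rare_above P (measurable_maxr mz me).
(* A point outside [B] serves two purposes: a small weight [zeta] for the decay
   and a small constant [eta] for the bound. *)
pose B := [set w | D%:R < Num.max (zeta w) (eta w)].
have mB : measurable B by exact: measurable_above (measurable_maxr mz me) _.
have mth := measurable_mpt_fun theta; have mthV := measurable_mpt_inv theta.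
have thP := mpt_preserving theta; have thVP := mpt_inv_preserving theta.
have ergV := ergodic_mpt_inv ergodic_theta.
pose halfF := half_avoids (R := R) theta B.
pose halfB := half_avoids (R := R) (mpt_inv theta) B.
have fullF : full_measure P halfF.
  apply: full_measure1; first exact: measurable_half_avoids.
  exact: half_avoids_full.
have fullB : full_measure P halfB.
  apply: full_measure1; first exact: measurable_half_avoids.
  exact: half_avoids_full.
pose G := Ot `&` halfF `&` halfB.
have fullG : full_measure P G by do 2 apply: full_measureI => //.
have invG : invariant_set theta G.
  apply: invariant_setI; first apply: invariant_setI => //.
    exact/invariant_set_preimage/half_avoids_invariant.
  exact/invariant_set_preimage_inv/half_avoids_invariant.
(* [D.+1] rather than [D], to have a positive constant. *)
have le_c (x y : R) : Num.max x y <= D%:R -> x <= D.+1%:R /\ y <= D.+1%:R.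
  rewrite ge_max => /andP[xD yD].
  have DD : D%:R <= D.+1%:R :> R by rewrite ler_nat.
  by split; [exact: le_trans xD DD|exact: le_trans yD DD].
have boundG w : G w -> admissible_bound theta Phi zeta D.+1%:R w.
  move=> [[Ow /half_avoids_visit[n nB]] _].
  apply: (@admissible_bound_iter _ _ _ _ _ _ _ _ _ n).
  set v := iter n theta w in nB *.
  have Ov : Ot v by exact: invariant_iter.
  have [_ ec] : zeta v <= D.+1%:R /\ eta v <= D.+1%:R.
    by apply: le_c; rewrite leNgt; apply/negP.
  apply: (admissible_bound_le _ ec); first by move=> u; exact: ltW.
  by apply: admissible_bound_of_norms (bound_Phi v Ov); exact: ltW.
have [green gP] := exists_green z0 admissible_Phi.
have GO w : G w -> Ot w by move=> [[]].
have gb v w : G w -> bounded_seq (green v w).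
  by move=> /GO; have [+ _ _] := gP v; apply.
have gs v w : G w -> solution_at theta Phi w (impulse v) (green v w).
  by move=> /GO; have [_ + _] := gP v; apply.
have gm v : measurable_on G (green v).
  have [_ _ m] := gP v; move=> n; apply: measurable_funS (m n) => //.
  by have [] := full_Ot.
have c0 : (0 : R) < D.+1%:R by rewrite ltr0n.
have zc w : ~ B w -> zeta w <= D.+1%:R.
  by move=> nB; have [] : zeta w <= D.+1%:R /\ eta w <= D.+1%:R
    by apply: le_c; rewrite leNgt; apply/negP.
have al0 : 0 < ln (1 + (D.+1%:R * D.+1%:R)^-1) / 2 :> R.
  by rewrite divr_gt0 // ln_gt0 // ltrDl invr_gt0 mulr_gt0.
have decay w (Gw : G w) :=
  green_back_decay cocycle_Phi z0 invG c0 boundG gb gs Gw zc Gw.1.2 Gw.2.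
have [Ps PsE] := exists_projections boundG gb gs decay.
exact: (dichotomy_of_green sepX cocycle_Phi log_integrable_Phi invG fullG
  boundG gb gs gm al0 decay PsE).
Qed.
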